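(* Let $b$ be a continuous $T$-periodic function. Given any sequence $\{t_i\}_{0\le i\le N+1}$ with $0=t_0<t_1<\dots<t_{N+1}=T$, denote $$\mathbb{A}=\{0\le i\le N: b(t)<0\text{ in }(t_i,t_{i+1})\},\quad \mathbb{B}=\{0\le i\le N: b(t)\equiv0\text{ on }[t_i,t_{i+1}]\},\quad \mathbb{C}=\{0\le i\le N: b(t)>0\text{ in }(t_i,t_{i+1})\}.$$ Assume $\mathbb{A}\cup\mathbb{B}\cup\mathbb{C}=\{0,\dots,N\}$. Let $\lambda(\alpha)$ be the principal eigenvalue of $$\begin{cases}\partial_t\varphi-\partial_{xx}\varphi-\alpha b(t)\partial_x\varphi+V(x,t)\varphi=\lambda\varphi & \text{in }(0,1)\times[0,T],\\ \partial_x\varphi(0,t)=\partial_x\varphi(1,t)=0 & \text{on }[0,T],\\ \varphi(x,0)=\varphi(x,T) & \text{on }(0,1).\end{cases}$$ Then $\lambda(\alpha)\to\lambda_\infty$ as $\alpha\to\infty$, where $\lambda_\infty$ is the principal eigenvalue of the following problem for $\psi$ on $[0,1]\times[0,T]$: - for each $i\in\mathbb{A}$: $\partial_t\psi+V(0,t)\psi=\lambda\psi$ in $(0,1)\times(t_i,t_{i+1}]$ and $\psi(x,t_i^+)\equiv\psi(0,t_i^-)$ on $(0,1)$; - for each $i\in\mathbb{B}$: $\partial_t\psi-\partial_{xx}\psi+V(x,t)\psi=\lambda\psi$ in $(0,1)\times(t_i,t_{i+1}]$ and $\psi(x,t_i^+)=\psi(x,t_i^-)$ on $(0,1)$; - for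 each $i\in\mathbb{C}$: $\partial_t\psi+V(1,t)\psi=\lambda\psi$ in $(0,1)\times(t_i,t_{i+1}]$ and $\psi(x,t_i^+)\equiv\psi(1,t_i^-)$ on $(0,1)$; - $\partial_x\psi(0,t)=\partial_x\psi(1,t)=0$ on $[0,T]$; - $\psi(x,0)=\psi(x,T)$ on $(0,1)$.
   Context: Standing assumptions: $T>0$; $\alpha>0$; $V\in C([0,1]\times\mathbb{R})$ is $T$-periodic in $t$. The principal eigenvalue $\lambda(\alpha)$ is the eigenvalue that is real and simple and whose eigenfunction can be chosen positive; it exists and satisfies $\lambda(\alpha)<\mathrm{Re}(\lambda)$ for every other eigenvalue $\lambda$. Notation: $\psi(\cdot,t^+)$ and $\psi(\cdot,t^-)$ are the right and left limits of $\psi$ at time $t$. At $t_0=0$, $\psi(\cdot,0^-)$ is understood by $T$-periodicity, i.e. $\psi(\cdot,0^-)=\psi(\cdot,0)=\psi(\cdot,T)$. The principal eigenvalue $\lambda_\infty$ of the limiting problem is the unique real number $\lambda$ for which that problem has a solution $\psi$ with $\psi>0$ on $[0,1]\times[0,T]$ ($\psi$ may be discontinuous in $t$ at the times $t_i$); existence and uniqueness of $\lambda_\infty$ are known. *)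

(* Defs.v *)
From mathcomp Require Import all_boot all_order all_algebra.
From mathcomp Require Import all_classical all_reals all_analysis.
From mathcomp.real_closed Require Import complex.

Set Implicit Arguments.
Unset Strict Implicit.
Unset Printing Implicit Defensive.

Import Order.TTheory GRing.Theory Num.Theory.
Import numFieldNormedType.Exports.

Local Open Scope classical_set_scope.
Local Open Scope ring_scope.

(* The derivative is one-sided at an end point of A that belongs to A. *)
Definition is_derive_within (R : realType) (A : set R) (f : R -> R)
    (x l : R) : Prop :=
  ((f y - f x) / (y - x)) @[y --> within A x^'] --> l.

(* V is only continuous in (x, t), so the parabolic equations below need not
   have classical (C^{2,1}) solutions.  They are understood in the usual strong
   sense: u and its genuine derivative ux are continuous on [0,1] x [a,c], and
   u_t, u_xx are weak derivatives (u is absolutely continuous in t for almost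
   every x, ux is absolutely continuous in x for almost every t).  This class
   contains C^{2,1}([0,1] x [a,c]) and, by Sobolev embedding,
   W^{2,1}_p((0,1) x (a,c)) for every p > 3. *)
Definition sobolev21 (R : realType) (a c : R) (u ux ut uxx : R -> R -> R)
    : Prop :=
  let mu := @lebesgue_measure R in
  let Q : set (R * R) := `[0, 1] `*` `[a, c] in
  [/\ {within Q, continuous (fun p : R * R => u p.1 p.2)},
      {within Q, continuous (fun p : R * R => ux p.1 p.2)}
    & forall x t, x \in `[0, 1] -> t \in `[a, c] ->
        is_derive_within `[0, 1] (fun y => u y t) x (ux x t)]
  /\
  [/\ (mu \x mu)%E.-integrable Q (fun p => (ut p.1 p.2)%:E),
      (mu \x mu)%E.-integrable Q (fun p => (uxx p.1 p.2)%:E),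
      {ae mu, forall x, x \in `]0, 1[ ->
        forall s t, a <= s -> s <= t -> t <= c ->
          u x t - u x s = Rintegral mu `[s, t] (fun r => ut x r)}
    & {ae mu, forall t, t \in `]a, c[ ->
        forall y x, 0 <= y -> y <= x -> x <= 1 ->
          ux x t - ux y t = Rintegral mu `[y, x] (fun z => uxx z t)}].

(* u_t - u_xx - beta(t) u_x + V u = f in (0,1) x (a,c). *)
Definition strong_solution (R : realType) (a c : R) (beta : R -> R)
    (V u f : R -> R -> R) : Prop :=
  let mu := @lebesgue_measure R in
  exists ux ut uxx : R -> R -> R,
    sobolev21 a c u ux ut uxx /\
    {ae (mu \x mu)%E, forall p, p.1 \in `]0, 1[ -> p.2 \in `]a, c[ ->
       ut p.1 p.2 - uxx p.1 p.2 - beta p.2 * ux p.1 p.2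
         + V p.1 p.2 * u p.1 p.2 = f p.1 p.2}.

Definition neumann (R : realType) (T : R) (u : R -> R -> R) : Prop :=
  forall t, t \in `[0, T] ->
    is_derive_within `[0, 1] (fun y => u y t) 0 0 /\
    is_derive_within `[0, 1] (fun y => u y t) 1 0.

Definition time_periodic (R : realType) (T : R) (u : R -> R -> R) : Prop :=
  forall x, x \in `]0, 1[ -> u x 0 = u x T.

Definition periodic_problem (R : realType) (T : R) (beta : R -> R)
    (V u f : R -> R -> R) : Prop :=
  [/\ strong_solution 0 T beta V u f, neumann T u & time_periodic T u].

(* The coefficients are real, so the equation for complex-valued functions is
   the pair of equations for the real and imaginary parts. *)
Definition complex_periodic_problem (R : realType) (T : R) (beta : R -> R)
    (V : R -> R -> R) (u f : R -> R -> R[i]) : Prop :=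
  periodic_problem T beta V (fun x t => complex.Re (u x t))
                            (fun x t => complex.Re (f x t)) /\
  periodic_problem T beta V (fun x t => complex.Im (u x t))
                            (fun x t => complex.Im (f x t)).

Definition eigenfunction (R : realType) (T : R) (beta : R -> R)
    (V : R -> R -> R) (m : R[i]) (phi : R -> R -> R[i]) : Prop :=
  complex_periodic_problem T beta V phi (fun x t => m * phi x t) /\
  exists x t, [/\ x \in `[0, 1], t \in `[0, T] & phi x t != 0].

(* Algebraic simplicity: the eigenspace is a line, and there is no generalized
   eigenvector above the eigenfunction. *)
Definition simple_eigenvalue (R : realType) (T : R) (beta : R -> R)
    (V : R -> R -> R) (m : R[i]) : Prop :=
  exists phi : R -> R -> R[i],
    [/\ eigenfunction T beta V m phi,
        forall chi, eigenfunction T beta V m chi ->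
          exists k : R[i], forall x t, x \in `[0, 1] -> t \in `[0, T] ->
            chi x t = k * phi x t
      & ~ exists w, complex_periodic_problem T beta V w
                      (fun x t => m * w x t + phi x t)].

Definition principal_eigenvalue (R : realType) (T : R) (beta : R -> R)
    (V : R -> R -> R) (lambda : R) : Prop :=
  simple_eigenvalue T beta V lambda%:C%C /\
  exists phi : R -> R -> R,
    eigenfunction T beta V lambda%:C%C (fun x t => (phi x t)%:C%C) /\
    forall x t, x \in `[0, 1] -> t \in `[0, T] -> 0 < phi x t.

Section LimitProblem.
Variables (R : realType) (N : nat) (ti : nat -> R) (b : R -> R).

Definition idxA : set nat :=
  [set i | (i <= N)%N /\ forall t, t \in `]ti i, ti i.+1[ -> b t < 0].

Definition idxB : set nat :=
  [set i | (i <= N)%N /\ forall t, t \in `[ti i, ti i.+1] -> b t = 0].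

Definition idxC : set nat :=
  [set i | (i <= N)%N /\ forall t, t \in `]ti i, ti i.+1[ -> 0 < b t].

Variables (T : R) (V : R -> R -> R).

(* The case of A (end = 0) and C (end = 1).  psi is left-continuous at each
   ti i with 0 < i, so psi (., (ti i)^-) is psi (., ti i); for i = 0 this is
   the convention psi (., 0^-) = psi (., 0). *)
Definition ode_piece (lambda : R) (psi : R -> R -> R) (i : nat) (e : R)
    : Prop :=
  [/\ {within `[0, 1] `*` `]ti i, ti i.+1],
         continuous (fun p : R * R => psi p.1 p.2)},
      forall x t, x \in `]0, 1[ -> t \in `]ti i, ti i.+1] ->
        exists2 d, is_derive_within `]ti i, ti i.+1] (psi x) t d
                 & d + V e t * psi x t = lambda * psi x t
    & forall x, x \in `]0, 1[ -> psi x s @[s --> (ti i)^'+] --> psi e (ti i)].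

(* Continuity up to time ti i makes psi (., (ti i)^+) = psi (., (ti i)^-) a
   uniform limit; a limit at each x of (0,1) alone would admit solutions that
   are singular at a corner (0, ti i) or (1, ti i). *)
Definition pde_piece (lambda : R) (psi : R -> R -> R) (i : nat) : Prop :=
  [/\ {within `[0, 1] `*` `[ti i, ti i.+1],
         continuous (fun p : R * R => psi p.1 p.2)},
      forall s, s \in `]ti i, ti i.+1[ ->
        strong_solution s (ti i.+1) (fun=> 0) V psi
          (fun x t => lambda * psi x t)
    & forall x, x \in `]0, 1[ -> psi x s @[s --> (ti i)^'+] --> psi x (ti i)].

Definition limit_problem (lambda : R) (psi : R -> R -> R) : Prop :=
  [/\ forall i, idxA i -> ode_piece lambda psi i 0,
      forall i, idxB i -> pde_piece lambda psi i,
      forall i, idxC i -> ode_piece lambda psi i 1,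
      neumann T psi
    & time_periodic T psi].

(* There is at most one such lambda. *)
Definition limit_principal_eigenvalue (lambda : R) : Prop :=
  exists psi : R -> R -> R,
    limit_problem lambda psi /\
    forall x t, x \in `[0, 1] -> t \in `[0, T] -> 0 < psi x t.

End LimitProblem.

(* Main.v *)
Require Import Defs.
From mathcomp Require Import all_boot all_order all_algebra.
From mathcomp Require Import all_classical all_reals all_analysis.
From mathcomp Require Import measurable_realfun.
From mathcomp.real_closed Require Import complex.
From mathcomp Require Import ring lra.

Set Implicit Arguments.
Unset Strict Implicit.
Unset Printing Implicit Defensive.

Import Order.TTheory GRing.Theory Num.Theory.
Import numFieldNormedType.Exports.

Local Open Scope classical_set_scope.
Local Open Scope ring_scope.

(** Write phi for the positive eigenfunction at alpha, psi for the positive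
    solution of the limit problem, and kappa = lam alpha - lamoo.  The heart of
    the matter is a statement about one stage [ti i, ti i.+1]: if phi <= k psi
    at the beginning of the stage, then at its end
      phi <= k exp (kappa (ti i.+1 - ti i)) exp eps psi,
    as soon as alpha is large, and likewise for lower bounds with exp (- eps)
    ([stage_growth]).  Composed over all stages, this bounds phi at time T by
    k exp (kappa T + (N+1) eps) psi (T).  If k is the maximum of phi / psi at
    time 0, then at a point where it is attained periodicity cancels phi and psi
    and leaves kappa T + (N+1) eps >= 0; the minimum of phi / psi gives the
    opposite bound ([eigenvalue_close]).  So only two given positive functions
    are compared, and no solution has to be constructed.

    On a stage where b vanishes, phi and exp (kappa t) psi solve the same heat
    equation and the comparison principle is enough ([diffusion_stage]).  On a
    stage where b has a sign, the drift sweeps the values at one end e of [0,1]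
    across the whole interval.  Let V have quadratic modulus of continuity at e,
    |V(x,t) - V(e,t)| <= d + K' (x-e)^2.  The barriers are
      Gamma(t) q(x,t)  and  Gamma(t) / q(x,t),
      q(x,t) = exp d + K (theta(t) (x-e)^2 + 2 Theta(t)),
    where Theta is the primitive of theta, theta' = M - alpha |b| theta,
    theta(start) = 1, and Gamma grows at the rate lam - V(e,t) +- d; the constant K
    is so large that q bounds psi / psi(e) and its reciprocal initially.  The term
    2 Theta compensates the diffusion of (x-e)^2, the drift term outweighs the
    decay of theta since |x-e| <= 1, and the source M pays for K' (x-e)^2.  As
    alpha grows, theta and Theta at the end of the stage tend to 0, so q tends to
    exp d there, and Gamma is, up to the factor exp (+- d |stage|), the explicit
    solution for lam on that stage ([barrier_time], [transport_barrier],
    [transport_stage], [ode_piece_value]).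

    The comparison principle must hold for solutions with merely integrable u_t
    and u_xx.  Integrating the equation over rectangles (Fubini) eliminates both:
    the time primitive P of u_x has x-derivative u - u(.,a) - H, where H is the
    time primitive of the continuous lower order terms ([integrated_equation]).
    Hence difference quotients in time of the time primitive of u are classical
    functions, uniformly close to u, which solve the equation up to a uniformly
    small error ([strong_solution_approx]).  The classical maximum principle
    applied to these approximations, with a barrier absorbing the errors, gives
    the comparison principle ([comparison]). *)

(** * Integrating the equation over rectangles *)

Lemma ae_xsection (R : realType) (P : R * R -> Prop) :
  {ae (@lebesgue_measure R \x @lebesgue_measure R)%E, forall p, P p} ->
  {ae @lebesgue_measure R, forall x,
     {ae @lebesgue_measure R, forall y, P (x, y)}}.
Proof.
move=> [N [mN N0 PN]].
have mx := measurable_fun_xsection (@lebesgue_measure R) mN.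
have : ae_eq (@lebesgue_measure R) setT
    (@lebesgue_measure R \o xsection N) (cst 0%E).
  apply/ae_eq_integral_abs => //.
  rewrite -[RHS]N0 /product_measure1; apply: eq_integral => x _ /=.
  by rewrite gee0_abs.
apply: filterS => x /(_ I) /= x0.
exists (xsection N x); split => //; first exact: measurable_xsection.
by move=> y /= nP; rewrite /xsection /= inE; apply: PN.
Qed.

Lemma ae_and (R : realType) (P Q : R -> Prop) :
  {ae @lebesgue_measure R, forall x, P x} ->
  {ae @lebesgue_measure R, forall x, Q x} ->
  {ae @lebesgue_measure R, forall x, P x /\ Q x}.
Proof.
have FF := ae_filter_ringOfSetsType (@lebesgue_measure R).
by move=> hP hQ; apply: (@filterS2 _ _ FF) hP hQ => x Px Qx; split.
Qed.

Lemma ae_sub2 (R : realType) (P Q S : R -> Prop) :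
  {ae @lebesgue_measure R, forall x, P x} ->
  {ae @lebesgue_measure R, forall x, Q x} ->
  (forall x, P x -> Q x -> S x) ->
  {ae @lebesgue_measure R, forall x, S x}.
Proof.
have FF := ae_filter_ringOfSetsType (@lebesgue_measure R).
by move=> hP hQ PQS; apply: (@filterS2 _ _ FF) PQS hP hQ.
Qed.

Section integrated_equation.
Variables (R : realType) (a c : R) (u ux ut uxx g : R -> R -> R).
Let mu := @lebesgue_measure R.
Hypothesis cu : forall t, continuous (u ^~ t).
Hypothesis cux : forall x, continuous (ux x).
Hypothesis cg : forall x, continuous (g x).
Hypothesis ciu : forall t, continuous (fun x => \int[mu]_(r in `[a, t]) g x r).
Let Q : set (R * R) := `[0, 1] `*` `[a, c].
Hypothesis iut : (mu \x mu)%E.-integrable Q (fun p => (ut p.1 p.2)%:E).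
Hypothesis iuxx : (mu \x mu)%E.-integrable Q (fun p => (uxx p.1 p.2)%:E).
Hypothesis hut : {ae mu, forall x, x \in `]0, 1[ ->
        forall s t, a <= s -> s <= t -> t <= c ->
          u x t - u x s = \int[mu]_(r in `[s, t]) (ut x r)}.
Hypothesis huxx : {ae mu, forall t, t \in `]a, c[ ->
        forall y x, 0 <= y -> y <= x -> x <= 1 ->
          ux x t - ux y t = \int[mu]_(z in `[y, x]) (uxx z t)}.
Hypothesis heq : {ae (mu \x mu)%E, forall p, p.1 \in `]0, 1[ -> p.2 \in `]a, c[ ->
       ut p.1 p.2 - uxx p.1 p.2 = g p.1 p.2}.

Lemma ae_section_integrable (h : R -> R -> R) D1 D2 :
  (mu \x mu)%E.-integrable (D1 `*` D2) (fun p => (h p.1 p.2)%:E) ->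
  @measurable _ (measurableTypeR R) D1 -> @measurable _ (measurableTypeR R) D2 ->
  {ae mu, forall x, D1 x -> mu.-integrable D2 (fun y => (h x y)%:E)}.
Proof.
move=> ih m1 m2.
have := ae_integrable1 ((integrable_mkcond _ (measurableX m1 m2)).1 ih).
apply: filterS => x ix Dx; apply/integrable_mkcond => //.
apply: eq_integrable ix => // y _; rewrite !patchE !in_setX /=.
by rewrite mem_set.
Qed.

Lemma ae_section_integrable2 (h : R -> R -> R) D1 D2 :
  (mu \x mu)%E.-integrable (D1 `*` D2) (fun p => (h p.1 p.2)%:E) ->
  measurable D1 -> measurable D2 ->
  {ae mu, forall y, D2 y -> mu.-integrable D1 (fun x => (h x y)%:E)}.
Proof.
move=> ih m1 m2.
have := ae_integrable2 ((integrable_mkcond _ (measurableX m1 m2)).1 ih).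
apply: filterS => y iy Dy; apply/integrable_mkcond => //.
apply: eq_integrable iy => // x _; rewrite !patchE !in_setX /=.
by rewrite (mem_set Dy) andbT.
Qed.

Lemma ae_neq (p : R) : {ae mu, forall s : R, s != p}.
Proof.
exists [set p]; split => //; first exact: lebesgue_measure_set1.
by move=> s /= /negP; rewrite negbK => /eqP.
Qed.

Lemma integral_sections (h : R -> R -> R) (D1 D2 : set R) :
  @measurable _ (measurableTypeR R) D1 -> @measurable _ (measurableTypeR R) D2 ->
  (mu \x mu)%E.-integrable (D1 `*` D2) (fun p => (h p.1 p.2)%:E) ->
  [/\ measurable_fun D1 (fun x => (\int[mu]_(y in D2) (h x y)%:E)%E : \bar R),
     measurable_fun D2 (fun y => (\int[mu]_(x in D1) (h x y)%:E)%E : \bar R) &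
  (\int[mu]_(x in D1) \int[mu]_(y in D2) (h x y)%:E =
   \int[mu]_(y in D2) \int[mu]_(x in D1) (h x y)%:E)%E].
Proof.
move=> m1 m2 ih.
have ih' := (integrable_mkcond _ (measurableX m1 m2)).1 ih.
set f := (X in integrable _ _ X) in ih'.
have E1 : fubini_F mu f = (fun x => \int[mu]_(y in D2) (h x y)%:E)%E \_ D1.
  apply/funext => x; rewrite /fubini_F patchE; case: ifPn => xD.
    rewrite [RHS]integral_mkcond; apply: eq_integral => y _.
    by rewrite /f !patchE in_setX /= xD.
  apply: integral0_eq => y _.
  by rewrite /f !patchE in_setX /= (negbTE xD).
have E2 : fubini_G mu f = (fun y => \int[mu]_(x in D1) (h x y)%:E)%E \_ D2.
  apply/funext => x; rewrite /fubini_G patchE; case: ifPn => xD.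
    rewrite [RHS]integral_mkcond; apply: eq_integral => y _.
    by rewrite /f !patchE in_setX /= xD andbT.
  apply: integral0_eq => y _.
  by rewrite /f !patchE in_setX /= (negbTE xD) andbF.
split.
- have := measurable_fubini_F ih'; rewrite E1.
  by move/(measurable_restrictT _ m1).
- have := measurable_fubini_G ih'; rewrite E2.
  by move/(measurable_restrictT _ m2).
- have := Fubini ih'.
  by rewrite -/(fubini_F mu f) -/(fubini_G mu f) E1 E2 -!integral_mkcond.
Qed.

(** Equality of the two iterated integrals of u_xx over [y,x] x [a,t]: one is
    evaluated by the absolute continuity of u_x, the other by the equation and
    the absolute continuity of u.  Both sides only involve continuous functions.
    The bounds on y, x and t keep the rectangle away from x = 0, x = 1 and t = c;
    the remaining side t = a is discarded as a null set. *)
Lemma integrated_equation (y x t : R) : 0 < y -> y <= x -> x < 1 -> a <= t -> t < c ->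
  \int[mu]_(s in `[a, t]) (ux x s - ux y s) =
  \int[mu]_(z in `[y, x]) (u z t - u z a - \int[mu]_(s in `[a, t]) g z s).
Proof.
move=> y0 yx x1 at_ tc.
have m1 : @measurable _ (measurableTypeR R) `[y, x] by [].
have m2 : @measurable _ (measurableTypeR R) `[a, t] by [].
have DQ : `[y, x] `*` `[a, t] `<=` Q.
  move=> [p q] [] /=; rewrite !in_itv /= => /andP[yp px] /andP[ap pt].
  by split; rewrite /= in_itv /= ?ap ?(le_trans pt (ltW tc))//
    (le_trans (ltW y0) yp) (le_trans px (ltW x1)).
have mQ : @measurable _ (measurableTypeR R * measurableTypeR R)%type Q.
  exact: measurableX.
have iD h : (mu \x mu)%E.-integrable Q (fun p => (h p.1 p.2)%:E) ->
    (mu \x mu)%E.-integrable (`[y, x] `*` `[a, t]) (fun p => (h p.1 p.2 : R)%:E).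
  by apply: integrableS => //; exact: measurableX.
have sxx := ae_section_integrable (iD _ iuxx) m1 m2.
have st := ae_section_integrable (iD _ iut) m1 m2.
have [mF mG fub] := integral_sections m1 m2 (iD _ iuxx).
have E1 : (\int[mu]_(z in `[y, x]) \int[mu]_(s in `[a, t]) (uxx z s)%:E =
   \int[mu]_(z in `[y, x]) (u z t - u z a - \int[mu]_(s in `[a, t]) g z s)%:E)%E.
  apply: ae_eq_integral => //.
    apply/measurable_EFinP; apply: measurable_funTS.
    apply: continuous_measurable_fun => z.
    rewrite /continuous_at.
    by apply: (@cvgB R R^o); [apply: (@cvgB R R^o); exact: cu|exact: ciu].
  have h1 := ae_and (ae_xsection heq) hut.
  have h2 := ae_and sxx st.
  apply: (ae_sub2 h1 h2) => z [pz uz] [ixx it] zD.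
  have z01 : z \in `]0, 1[.
    move: zD; rewrite /= !in_itv /= => /andP[yz zx].
    by rewrite (lt_le_trans y0 yz) (le_lt_trans zx x1).
  have ig : mu.-integrable `[a, t] (EFin \o g z).
    apply: continuous_compact_integrable; first exact: segment_compact.
    by apply: continuous_subspaceT; exact: cg.
  have fK := fineK (integrable_fin_num m2 (ixx zD)).
  rewrite -fK; congr EFin.
  rewrite (uz z01 a t) ?(ltW tc)//.
  rewrite -(@RintegralB _ _ _ mu `[a, t] (ut z) (g z) m2)//; last exact: it.
  congr fine; apply: ae_eq_integral => //.
  - exact: measurable_int (ixx zD).
  - apply/measurable_EFinP; apply: measurable_funB.
      by apply/measurable_EFinP; exact: measurable_int (it zD).
    by apply/measurable_EFinP; exact: measurable_int ig.
  - apply: (ae_sub2 pz (ae_neq a)) => s /= ps sa.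
    rewrite in_itv /= => /andP[as_ st'].
    rewrite -(ps z01) ?subKr// in_itv /= lt_neqAle eq_sym sa as_.
    exact: le_lt_trans tc.
have E2 : (\int[mu]_(s in `[a, t]) \int[mu]_(z in `[y, x]) (uxx z s)%:E =
   \int[mu]_(s in `[a, t]) (ux x s - ux y s)%:E)%E.
  apply: ae_eq_integral => //.
    apply/measurable_EFinP; apply: measurable_funTS.
    apply: continuous_measurable_fun => z.
    by rewrite /continuous_at; apply: (@cvgB R R^o); exact: cux.
  have h1 := ae_and huxx (ae_neq a).
  have h2 := ae_section_integrable2 (iD _ iuxx) m1 m2.
  apply: (ae_sub2 h1 h2) => s [us sa] ixx sD.
  have fK := fineK (integrable_fin_num m1 (ixx sD)).
  rewrite -fK; congr EFin.
  rewrite us ?(ltW y0) ?(ltW x1)//.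
  move: sD; rewrite /= !in_itv /= => /andP[as_ st'].
  by rewrite lt_neqAle eq_sym sa as_ (le_lt_trans st' tc).
by rewrite /Rintegral -E2 -E1 fub.
Qed.
End integrated_equation.

(** * Continuity on boxes *)
Section continuity.
Variable R : realType.
Implicit Types f : R -> R -> R.

Lemma within_continuous2P (Q : set (R * R)) f :
  {within Q, continuous (fun p => f p.1 p.2)} <->
  forall x t, Q (x, t) -> forall e, 0 < e -> exists2 d, 0 < d &
    forall y s, Q (y, s) -> `|y - x| < d -> `|s - t| < d ->
      `|f y s - f x t| < e.
Proof.
rewrite subspace_continuousP; split => [cf x t Qxt e e0|cf [x t] Qxt].
  have /cvgrPdist_lt/(_ _ e0) := cf _ Qxt.
  rewrite near_withinE => /nbhs_ballP[d /= d0 hd]; exists d => // y s Qys yx st.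
  rewrite distrC; apply: (hd (y, s)) => //; split; rewrite /= /ball /=.
    by rewrite distrC.
  by rewrite distrC.
apply/cvgrPdist_lt => e e0; rewrite near_withinE.
have [d d0 hd] := cf _ _ Qxt _ e0.
apply/nbhs_ballP; exists d => // -[y s] [/= yx st] Qys.
rewrite distrC; apply: hd => //; first by rewrite distrC; exact: yx.
by rewrite distrC; exact: st.
Qed.

Lemma continuous_at2P f x t :
  {for (x, t), continuous (fun p => f p.1 p.2)} <->
  forall e, 0 < e -> exists2 d, 0 < d &
    forall y s, `|y - x| < d -> `|s - t| < d -> `|f y s - f x t| < e.
Proof.
split => [cf e e0|cf].
  have /cvgrPdist_lt/(_ _ e0) H := cf.
  have /nbhs_ballP[d /= d0 hd] : nbhs ((x, t) : R * R) _ := H.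
  exists d => // y s yx st.
  rewrite distrC; apply: (hd (y, s)) => //; split; rewrite /= /ball /=.
    by rewrite distrC.
  by rewrite distrC.
apply/cvgrPdist_lt => e e0.
have [d d0 hd] := cf _ e0.
apply: (nbhs_ballP ((x, t) : R * R) _).2; exists d => // -[y s] [/= yx st].
rewrite distrC; apply: hd => //; first by rewrite distrC; exact: yx.
by rewrite distrC; exact: st.
Qed.

Lemma continuous2P f :
  continuous (fun p => f p.1 p.2) <->
  forall x t e, 0 < e -> exists2 d, 0 < d &
    forall y s, `|y - x| < d -> `|s - t| < d -> `|f y s - f x t| < e.
Proof.
split => [cf x t|cf [x t]]; first by apply/continuous_at2P; exact: cf.
by apply/continuous_at2P; exact: cf.
Qed.

Lemma continuous2_l f t :
  continuous (fun p => f p.1 p.2) -> continuous (f ^~ t).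
Proof.
move=> /continuous2P cf x; apply/cvgrPdist_lt => e e0.
have [d d0 hd] := cf x t e e0.
apply/nbhs_ballP; exists d => // y /= xy.
by rewrite distrC hd ?subrr ?normr0// distrC.
Qed.

Lemma continuous2_r f x :
  continuous (fun p => f p.1 p.2) -> continuous (f x).
Proof.
move=> /continuous2P cf t; apply/cvgrPdist_lt => e e0.
have [d d0 hd] := cf x t e e0.
apply/nbhs_ballP; exists d => // s /= ts.
by rewrite distrC hd ?subrr ?normr0// distrC.
Qed.

(** Composing with [clamp] turns continuity within a box into global continuity
    without changing the values in the box. *)
Definition clamp (a c x : R) := Num.max a (Num.min x c).

Lemma clamp_itv a c x : a <= c -> clamp a c x \in `[a, c].
Proof.
move=> ac; rewrite /clamp in_itv /= le_max lexx /= ge_max ac /= ge_min lexx.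
by rewrite orbT.
Qed.

Lemma clamp_id a c x : x \in `[a, c] -> clamp a c x = x.
Proof.
by rewrite in_itv /= => /andP[ax xc]; rewrite /clamp min_l// max_r.
Qed.

Lemma clamp_contract a c x y : `|clamp a c x - clamp a c y| <= `|x - y|.
Proof.
have n (u v : R) : u - v <= `|u - v| /\ v - u <= `|u - v|.
  by split; [exact: ler_norm|rewrite distrC; exact: ler_norm].
apply: (@le_trans _ _ `|Num.min x c - Num.min y c|).
  rewrite /clamp; set u := Num.min x c; set v := Num.min y c.
  have [n1 n2] := n u v; rewrite ler_norml.
  case: (lerP a u) => ?; case: (lerP a v) => ?; apply/andP; split; lra.
have [n1 n2] := n x y; rewrite ler_norml.
case: (lerP x c) => ?; case: (lerP y c) => ?; apply/andP; split; lra.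
Qed.

Lemma continuous_clamp (a c : R) f : a <= c ->
  {within `[0, 1] `*` `[a, c], continuous (fun p => f p.1 p.2)} ->
  continuous (fun p => f (clamp 0 1 p.1) (clamp a c p.2)).
Proof.
move=> ac /within_continuous2P cf.
apply/(continuous2P (fun x t => f (clamp 0 1 x) (clamp a c t))) => x t e e0.
have cQ y s : (`[0, 1] `*` `[a, c]) (clamp 0 1 y, clamp a c s).
  by split; apply: clamp_itv.
have [d d0 hd] := cf _ _ (cQ x t) e e0.
exists d => // y s yx st; apply: hd => //.
  exact: le_lt_trans (clamp_contract _ _ _ _) yx.
exact: le_lt_trans (clamp_contract _ _ _ _) st.
Qed.

(** Only one of the two points has to lie in the box, hence no restriction on
    (y, s); this is what the near-covering form of compactness provides. *)
Lemma heine (p q a c : R) f : continuous (fun p => f p.1 p.2) ->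
  forall e, 0 < e -> exists2 d, 0 < d &
    forall x t, x \in `[p, q] -> t \in `[a, c] -> forall y s,
      `|y - x| < d -> `|s - t| < d -> `|f y s - f x t| < e.
Proof.
move=> /continuous2P cf e e0.
have cK : compact (`[p, q] `*` `[a, c] : set (R * R)).
  by apply: compact_setX; exact: segment_compact.
have H : \forall d \near nbhs (0 : R)^'+, forall w : R * R,
    (`[p, q] `*` `[a, c]) w -> forall y s, `|y - w.1| < d -> `|s - w.2| < d ->
      `|f y s - f w.1 w.2| < e.
  apply: ((compact_near_coveringP _).1 cK) => -[x t] _.
  have [d d0 hd] := cf x t (e / 2) (divr_gt0 e0 (ltr0Sn _ _)).
  have d20 : 0 < d / 2 by rewrite divr_gt0.
  exists (ball (x, t) (d / 2), [set r | r < d / 2]) => /=.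
    split; first exact: nbhsx_ballx.
    exact: nbhs_right_lt.
  move=> [[x' t'] r] /= [[/= xx' tt'] rd] y s yx' st'.
  move: xx' tt'; rewrite /ball /= => xx' tt'.
  have -> : f y s - f x' t' = (f y s - f x t) - (f x' t' - f x t) by ring.
  rewrite (le_lt_trans (ler_normB _ _))// [ltRHS](splitr e) ltrD// hd//.
  - rewrite -(subrK x' y) -addrA (le_lt_trans (ler_normD _ _))//.
    by rewrite [ltRHS]splitr ltrD// 1?(lt_trans yx')// distrC.
  - rewrite -(subrK t' s) -addrA (le_lt_trans (ler_normD _ _))//.
    by rewrite [ltRHS]splitr ltrD// 1?(lt_trans st')// distrC.
  - by rewrite distrC (lt_trans xx')// ltr_pdivrMr// ltr_pMr// ltr1n.
  - by rewrite distrC (lt_trans tt')// ltr_pdivrMr// ltr_pMr// ltr1n.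
have [d [d0 hd]] : exists d : R, 0 < d /\ forall w, (`[p, q] `*` `[a, c]) w ->
    forall y s, `|y - w.1| < d -> `|s - w.2| < d -> `|f y s - f w.1 w.2| < e.
  have [d [d0 hd]] := filter_ex (filterI (nbhs_right_gt (0 : R)) H).
  by exists d; split => // p Kp; exact: hd.
exists d => // x t x01 tac y s; exact: (hd (x, t)).
Qed.

Lemma bounded_box (p q a c : R) f : p <= q -> a <= c ->
  {within `[p, q] `*` `[a, c], continuous (fun p => f p.1 p.2)} ->
  exists2 M, 0 < M & forall x t, x \in `[p, q] -> t \in `[a, c] -> `|f x t| <= M.
Proof.
move=> pq ac cf.
have cK : compact (`[p, q] `*` `[a, c] : set (R * R)).
  by apply: compact_setX; exact: segment_compact.
have K0 : (`[p, q] `*` `[a, c] : set (R * R)) !=set0.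
  by exists (p, a); split; rewrite /= in_itv /= lexx ?pq ?ac.
have cn : {within `[p, q] `*` `[a, c], continuous (fun p => `|f p.1 p.2|)}.
  by move=> w; apply: (@cvg_norm R R^o); exact: cf.
have [[x0 t0] _ hm] := compact_EVT_max K0 cK cn.
exists (`|f x0 t0| + 1); first by rewrite ltr_wpDl.
move=> x t x01 tac; rewrite (le_trans (hm (x, t) _))//= ?lerDl//.
by rewrite inE.
Qed.

End continuity.

(** * Primitives in time *)
Section time_primitives.
Variable R : realType.
Implicit Types (a c t x y s : R) (h hx : R -> R -> R).
Let mu := @lebesgue_measure R.

Definition time_primitive a h x t : R := \int[lebesgue_measure]_(s in `[a, t]) h x s.

Lemma integrable_slice a c h x : continuous (fun p => h p.1 p.2) ->
  mu.-integrable `[a, c] (EFin \o h x).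
Proof.
move=> ch; apply: continuous_compact_integrable; first exact: segment_compact.
by apply: continuous_subspaceT; exact: continuous2_r.
Qed.

Lemma is_derive_time_primitive a h x t : continuous (fun p => h p.1 p.2) -> a < t ->
  is_derive t 1 (time_primitive a h x) (h x t).
Proof.
move=> ch at_.
have tt : t < t + 1 by rewrite ltrDl.
have [dF F'] := continuous_FTC1_closed tt (integrable_slice a (t + 1) x ch) at_
  (@continuous2_r _ _ x ch t).
by apply: DeriveDef; [exact: dF|rewrite -derive1E; exact: F'].
Qed.

Lemma is_derive_time_primitive_param a t h hx x : a <= t ->
  continuous (fun p => h p.1 p.2) -> continuous (fun p => hx p.1 p.2) ->
  (forall y s, 0 < y < 1 -> a <= s <= t -> is_derive y 1 (h ^~ s) (hx y s)) ->
  0 < x < 1 -> is_derive x 1 (fun y => time_primitive a h y t) (time_primitive a hx x t).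
Proof.
move=> at_ ch chx dh x01.
have [M M0 hM] := bounded_box (@ler01 R) at_ (continuous_subspaceT chx).
have m : @measurable _ (measurableTypeR R) `[a, t] by [].
have x01' : `]0, 1[%classic x by rewrite /= in_itv.
have d1E y s : `]0, 1[%classic y -> `[a, t]%classic s ->
    partial1of2 h y s = hx y s.
  rewrite /= !in_itv /= => y01 sat; rewrite partial1of2E.
  by have := dh y s y01 sat => ?; rewrite derive_val.
have hd y s : `]0, 1[%classic y -> `[a, t]%classic s -> derivable (h ^~ s) y 1.
  by rewrite /= !in_itv /= => y01 sat; have [] := dh y s y01 sat.
have iM : mu.-integrable `[a, t] (EFin \o cst M).
  apply: continuous_compact_integrable; first exact: segment_compact.
  by apply: continuous_subspaceT => ?; exact: cvg_cst.
have hG y s : `]0, 1[%classic y -> `[a, t]%classic s ->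
    `|partial1of2 h y s| <= cst M s.
  move=> y01 sat; rewrite d1E//; move: y01 sat; rewrite /= !in_itv /=.
  by move=> /andP[? ?] sat; apply: hM; rewrite in_itv /= ?sat// !ltW.
have ih y : `]0, 1[%classic y -> mu.-integrable `[a, t] (EFin \o h y).
  by move=> _; exact: integrable_slice.
have M0' s : 0 <= cst M s :> R by rewrite /= ltW.
apply: DeriveDef.
  exact: (derivable_under_integral m x01' ih hd M0' iM hG).
rewrite -derive1E (differentiation_under_integral m x01' ih hd M0' iM hG).
by apply: eq_Rintegral => s; rewrite inE => sat; rewrite d1E.
Qed.

Lemma continuous_time_primitive a t h : continuous (fun p => h p.1 p.2) ->
  continuous (fun x => time_primitive a h x t).
Proof.
move=> ch x.
have [at_|ta] := leP a t; last first.
  rewrite /time_primitive set_itv_ge; last by rewrite bnd_simp -ltNge.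
  by under eq_fun do rewrite Rintegral_set0; exact: cvg_cst.
have xx : x - 1 <= x + 1 by lra.
have [M M0 hM] := bounded_box xx at_ (continuous_subspaceT ch).
have m : @measurable _ (measurableTypeR R) `[a, t] by [].
have xI : x \in `]x - 1, x + 1[%classic.
  by rewrite inE /= in_itv /=; apply/andP; split; lra.
have iM : mu.-integrable `[a, t] (EFin \o cst M).
  apply: continuous_compact_integrable; first exact: segment_compact.
  by apply: continuous_subspaceT => ?; exact: cvg_cst.
apply: (continuity_under_integral m _ _ iM _ xI) => //.
- by move=> y _; exact: integrable_slice.
- by apply: aeW => s _ y _; exact: continuous2_l.
- move=> y; rewrite /= in_itv /= => /andP[? ?]; apply: aeW => s sI.
  by apply: hM => //; rewrite in_itv /= !ltW.
Qed.

(** Difference quotients in t of a time primitive are values of the integrand;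
    with uniform continuity this makes Steklov averages uniformly close to it. *)
Lemma time_primitive_mean a h x t d : continuous (fun p => h p.1 p.2) -> a < t -> 0 < d ->
  exists2 s, s \in `[t, t + d] &
    time_primitive a h x (t + d) - time_primitive a h x t = h x s * d.
Proof.
move=> ch at_ d0.
have tt : t <= t + d by rewrite lerDl ltW.
have dd s : s \in `[t, t + d] -> is_derive s 1 (time_primitive a h x) (h x s).
  rewrite in_itv /= => /andP[ts _]; apply: is_derive_time_primitive => //.
  exact: lt_le_trans ts.
have [|s sI E] := MVT_segment tt (fun s sI => dd s (subset_itv_oo_cc sI)).
  apply: derivable_within_continuous => s sI.
  by have [] := dd s sI.
by exists s => //; rewrite E addrAC subrr add0r.
Qed.

Lemma continuous2_time_primitive a h x t : continuous (fun p => h p.1 p.2) -> a < t ->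
  {for (x, t), continuous (fun p => time_primitive a h p.1 p.2)}.
Proof.
move=> ch at_; apply/continuous_at2P => e e0.
have xx : x - 1 <= x + 1 by lra.
have at1 : a <= t + 1 by rewrite ltW// ltr_wpDr.
have [M M0 hM] := bounded_box xx at1 (continuous_subspaceT ch).
have e20 : 0 < e / 2 by rewrite divr_gt0.
have /cvgrPdist_lt/(_ _ e20)/nbhs_ballP[d1 /= d10 hd] := @continuous_time_primitive a t h ch x.
exists (Num.min (Num.min d1 1) (Num.min (t - a) (Num.min 1 (e / 2 / M)))).
  by rewrite !lt_min d10 ltr01 subr_gt0 at_ divr_gt0.
move=> y s; rewrite !lt_min => /and3P[/andP[yd1 y1] _ _].
move=> /andP[_ /and3P[sta st1 ste]].
have -> : time_primitive a h y s - time_primitive a h x t =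
   (time_primitive a h y s - time_primitive a h y t) +
   (time_primitive a h y t - time_primitive a h x t) by ring.
rewrite (le_lt_trans (ler_normD _ _))// [ltRHS]splitr ltrD//; last first.
  by rewrite distrC; apply: hd; rewrite /ball /= distrC.
have yI : y \in `[x - 1, x + 1].
  by move: y1; rewrite in_itv /= ltr_norml => /andP[? ?]; apply/andP; split; lra.
have [/andP[as_ st]] : a < s < t + 1 /\ True.
  split=> //; move: sta st1; rewrite !ltr_norml => /andP[? ?] /andP[? ?].
  by apply/andP; split; lra.
move=> _.
suff {ste} H : `|time_primitive a h y s - time_primitive a h y t| <= M * `|s - t|.
  by rewrite (le_lt_trans H)// mulrC -ltr_pdivlMr.
have [ts|] := ltP t s.
  have d0 : 0 < s - t by rewrite subr_gt0.
  have [r rI] := time_primitive_mean y ch at_ d0.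
  rewrite (addrC t) subrK => ->; rewrite normrM ler_wpM2r// hM//.
  move: rI; rewrite !in_itv /= (addrC t) subrK => /andP[tr rs].
  by rewrite (le_trans (ltW at_) tr) (le_trans rs (ltW st)).
rewrite le_eqVlt => /predU1P[->|st']; first by rewrite !subrr normr0 mulr0.
have d0 : 0 < t - s by rewrite subr_gt0.
have [r rI] := time_primitive_mean y ch as_ d0.
rewrite (distrC _ (time_primitive a h y t)) (distrC s).
rewrite (addrC s) subrK => ->; rewrite normrM ler_wpM2r// hM//.
move: rI; rewrite !in_itv /= (addrC s) subrK => /andP[tr rs].
by rewrite (le_trans (ltW as_) tr) (le_trans rs)// ltW// ltr_pwDr.
Qed.

End time_primitives.

(** * Derivatives of functions of one variable *)
Section derivatives.
Variable R : realType.
Implicit Types f g : R -> R.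

Lemma is_deriveP f (x l : R) : is_derive x 1 f l <->
  forall e, 0 < e -> exists2 d, 0 < d &
    forall y, `|y - x| < d -> `|f y - f x - l * (y - x)| <= e * `|y - x|.
Proof.
split=> [[df dl] e e0|H].
  have /cvgrPdist_le/(_ _ e0) := df; rewrite -/(derive f x 1) dl.
  move=> /nbhs_ballP[d /= d0 hd]; exists d => // y yx.
  have [->|yNx] := eqVneq y x; first by rewrite !subrr mulr0 subr0 normr0 mulr0.
  have h0 : y - x != 0 by rewrite subr_eq0.
  have := hd (y - x); rewrite /ball /= sub0r normrN => /(_ yx h0).
  rewrite /GRing.scale /= mulr1 subrK => H.
  rewrite -ler_pdivrMr ?normr_gt0// -normf_div mulrBl mulfK//.
  by rewrite distrC mulrC.
have Hc : h^-1 *: (f (h *: 1 + x) - f x) @[h --> 0^'] --> l.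
  apply/cvgrPdist_le => e e0; have [d d0 hd] := H e e0.
  apply/nbhs_ballP; exists d => // h; rewrite /ball /= sub0r normrN => hd' h0.
  rewrite /GRing.scale /= mulr1 distrC.
  have := hd (h + x); rewrite addrK => /(_ hd').
  rewrite -ler_pdivrMr ?normr_gt0// -normf_div mulrBl mulfK//.
  by rewrite (mulrC h^-1).
apply: DeriveDef; first by apply/cvg_ex; exists l.
exact/cvg_lim.
Qed.

Lemma is_derive_near f g (x l r : R) : 0 < r ->
  (forall y, `|y - x| < r -> f y = g y) -> is_derive x 1 f l ->
  is_derive x 1 g l.
Proof.
move=> r0 fg /is_deriveP H; apply/is_deriveP => e e0.
have [d d0 hd] := H e e0; exists (Num.min d r); first by rewrite lt_min d0.
move=> y; rewrite lt_min => /andP[yd yr]; rewrite -!fg//; first exact: hd.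
by rewrite subrr normr0.
Qed.

Lemma is_derive_shiftr f (x l h : R) : is_derive (x + h) 1 f l ->
  is_derive x 1 (fun y => f (y + h)) l.
Proof.
move=> /is_deriveP H; apply/is_deriveP => e e0.
have [d d0 hd] := H e e0; exists d => // y yx.
have E : y + h - (x + h) = y - x by ring.
by have := hd (y + h); rewrite E; exact.
Qed.

Lemma is_derive_affine f (x l h k : R) : is_derive x 1 f l ->
  is_derive x 1 (fun y => k * (f y - h)) (k * l).
Proof.
move=> df.
have -> : k * l = k *: (l - 0) by rewrite subr0.
exact: (is_deriveZ k (is_deriveB df (is_derive_cst h x 1))).
Qed.

Lemma is_derive_mul f g (x a b : R) : is_derive x 1 f a -> is_derive x 1 g b ->
  is_derive x 1 (fun y => f y * g y) (a * g x + f x * b).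
Proof.
move=> df dg.
have -> : a * g x + f x * b = f x *: b + g x *: a.
  by rewrite /GRing.scale /= addrC mulrC (mulrC (g x)) mulrC.
exact: is_deriveM.
Qed.

(** One-sided maxima are what occurs at the final time of a parabolic box. *)
Lemma is_derive_max_left f (x l r : R) : 0 < r -> is_derive x 1 f l ->
  (forall y, x - r < y < x -> f y <= f x) -> 0 <= l.
Proof.
move=> r0 /is_deriveP H fx; rewrite leNgt; apply/negP => l0.
have [|d d0 hd] := H (- l / 2); first by lra.
pose m := Num.min d r / 2.
have m0 : 0 < m by rewrite divr_gt0// lt_min d0.
have md : m < d by rewrite ltr_pdivrMr// (@le_lt_trans _ _ d) ?ge_min ?lexx//; lra.
have mr : m < r by rewrite ltr_pdivrMr// (@le_lt_trans _ _ r) ?ge_min ?lexx ?orbT//; lra.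
have := hd (x - m); have -> : x - m - x = - m by ring.
rewrite normrN gtr0_norm// => /(_ md); rewrite ler_norml => /andP[h _].
have := fx (x - m); rewrite !ltrBlDr => /(_ _) fm.
have {}fm : f (x - m) <= f x by apply: fm; apply/andP; split; lra.
have : 0 < (- l / 2) * m by rewrite mulr_gt0//; lra.
nra.
Qed.

Lemma is_derive_max_right f (x l r : R) : 0 < r -> is_derive x 1 f l ->
  (forall y, x < y < x + r -> f y <= f x) -> l <= 0.
Proof.
move=> r0 df fx.
have dN : is_derive (- x) 1 (fun y => f (- y)) (- l).
  move: df => /is_deriveP H; apply/is_deriveP => e e0.
  have [d d0 hd] := H e e0; exists d => // y yx.
  move: yx; rewrite !opprK => yx.
  have E : - y - x = - (y + x) by ring.
  by have := hd (- y); rewrite E normrN mulrN mulNr; exact.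
suff : 0 <= - l by rewrite oppr_ge0.
apply: (is_derive_max_left r0 dN) => y /andP[? ?]; rewrite opprK.
by apply: fx; apply/andP; split; lra.
Qed.

End derivatives.

(** * Classical approximation of strong solutions *)
Section approximation.
Variable R : realType.
Implicit Types (a c lambda x t y s : R) (u v q f V : R -> R -> R) (beta : R -> R).

(** At the initial time nothing but continuity is asked, at the final time the
    two-sided time derivative exists: the boxes used lie inside larger ones. *)
Definition classical_on a c (v vx vxx vt : R -> R -> R) : Prop :=
  [/\ {within `[0, 1] `*` `[a, c], continuous (fun p : R * R => v p.1 p.2)},
      forall t, a <= t <= c -> {within `[0, 1], continuous (vx ^~ t)}
    & forall x t, 0 < x < 1 -> a < t <= c ->
        [/\ is_derive x 1 (v ^~ t) (vx x t),
            is_derive x 1 (vx ^~ t) (vxx x t)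
          & is_derive t 1 (v x) (vt x t)]].

(** Subsolutions of u_t - u_xx - beta u_x + q u <= 0 with Neumann conditions, in
    the sense of uniform limits of classical functions that satisfy the
    inequalities up to a uniform error.  Only interior time intervals are
    required, so that Steklov averages, which look ahead in time, qualify. *)
Definition approx_subsolution a c beta q u : Prop :=
  forall a' c' e, a < a' -> a' < c' -> c' < c -> 0 < e ->
  exists v vx vxx vt, classical_on a' c' v vx vxx vt /\
    forall x t, 0 <= x <= 1 -> a' <= t <= c' ->
      [/\ `|v x t - u x t| <= e, - e <= vx 0 t, vx 1 t <= e
        & 0 < x < 1 ->
          vt x t - vxx x t - beta t * vx x t + q x t * v x t <= e].

Definition approx_solution a c beta q u : Prop :=
  forall a' c' e, a < a' -> a' < c' -> c' < c -> 0 < e ->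
  exists v vx vxx vt, classical_on a' c' v vx vxx vt /\
    forall x t, 0 <= x <= 1 -> a' <= t <= c' ->
      [/\ `|v x t - u x t| <= e, `|vx 0 t| <= e, `|vx 1 t| <= e
        & 0 < x < 1 ->
          `|vt x t - vxx x t - beta t * vx x t + q x t * v x t| <= e].


Lemma is_derive_withinP (A : set R) (g : R -> R) x (l : R) :
  is_derive_within A g x l <->
  forall e : R, 0 < e -> exists2 d : R, 0 < d &
    forall y, A y -> y != x -> `|y - x| < d ->
      `|(g y - g x) / (y - x) - l| <= e.
Proof.
rewrite /is_derive_within; split => [/cvgrPdist_le H e e0|H].
  have := H e e0; rewrite !near_withinE => /nbhs_ballP[d /= d0 hd].
  exists d => // y Ay yx yd; rewrite distrC; apply: (hd y) => //.
  by rewrite /ball /= distrC.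
apply/cvgrPdist_le => e e0; have [d d0 hd] := H e e0.
rewrite !near_withinE; apply/nbhs_ballP; exists d => // y /=.
rewrite /ball /= distrC => yd yx Ay; rewrite distrC; exact: hd.
Qed.

Lemma is_derive_within_clamp (g : R -> R) x (l : R) : 0 < x < 1 ->
  is_derive_within `[0, 1] g x l ->
  is_derive x 1 (fun y => g (clamp 0 1 y)) l.
Proof.
move=> /andP[x0 x1] /is_derive_withinP H; apply/is_deriveP => e e0.
have [d d0 hd] := H e e0.
exists (Num.min d (Num.min x (1 - x))).
  by rewrite !lt_min d0 x0 subr_gt0.
move=> y; rewrite !lt_min => /and3P[yd yx yx1].
have yI : y \in `[0, 1].
  move: yx yx1; rewrite !ltr_norml in_itv /= => /andP[? ?] /andP[? ?].
  by apply/andP; split; lra.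
have xI : x \in `[0, 1] by rewrite in_itv /= !ltW.
rewrite !clamp_id//.
have [->|yNx] := eqVneq y x; first by rewrite !subrr mulr0 subr0 normr0 mulr0.
have h0 : y - x != 0 by rewrite subr_eq0.
rewrite -ler_pdivrMr ?normr_gt0// -normf_div mulrBl mulfK//.
exact: hd.
Qed.

Lemma is_derive_within_unique (g : R -> R) x (l m : R) : x \in `[0, 1] ->
  is_derive_within `[0, 1] g x l -> is_derive_within `[0, 1] g x m -> l = m.
Proof.
rewrite in_itv /= => /andP[x0 x1] /is_derive_withinP Hl /is_derive_withinP Hm.
apply/eqP; rewrite -subr_eq0 -normr_le0; apply/ler_addgt0Pr => e e0.
have e2 : 0 < e / 2 by lra.
have [d1 d10 h1] := Hl _ e2; have [d2 d20 h2] := Hm _ e2.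
pose m0 := Num.min (Num.min d1 d2) 1.
have m00 : 0 < m0 by rewrite !lt_min d10 d20 ltr01.
have [m1 m2 m3] : [/\ m0 <= d1, m0 <= d2 & m0 <= 1].
  by rewrite /m0 !ge_min !lexx !orbT.
have [y [yI yx yd]] : exists y, [/\ `[0, 1]%classic y, y != x & `|y - x| < m0].
  have [xh|xh] := leP x (1 / 2).
    exists (x + m0 / 2); rewrite /= in_itv /=; split.
    - by apply/andP; split; lra.
    - by rewrite -subr_eq0 addrAC subrr add0r gt_eqF//; lra.
    - by rewrite addrAC subrr add0r gtr0_norm; lra.
  exists (x - m0 / 2); rewrite /= in_itv /=; split.
  - by apply/andP; split; lra.
  - by rewrite -subr_eq0 addrAC subrr add0r oppr_eq0 gt_eqF//; lra.
  - by rewrite addrAC subrr add0r normrN gtr0_norm; lra.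
have H1 := h1 y yI yx (lt_le_trans yd m1).
have H2 := h2 y yI yx (lt_le_trans yd m2).
have -> : l - m = ((g y - g x) / (y - x) - m) - ((g y - g x) / (y - x) - l).
  by ring.
by rewrite (le_trans (ler_normB _ _))// add0r [leRHS]splitr lerD.
Qed.

(** The given solution and its coefficients are frozen outside the box by
    [clamp]; [avg] below is the forward average over [t, t + d]. *)
Section steklov.
Variables (a c lambda : R) (beta : R -> R) (V u ux ut uxx : R -> R -> R).
Hypothesis ac : a < c.
Hypothesis cbeta : continuous beta.
Hypothesis cV :
  {within `[0, 1] `*` [set: R], continuous (fun p : R * R => V p.1 p.2)}.
Hypothesis su : sobolev21 a c u ux ut uxx.
Hypothesis pde : {ae (@lebesgue_measure R \x @lebesgue_measure R)%E, forall p,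
  p.1 \in `]0, 1[ -> p.2 \in `]a, c[ ->
  ut p.1 p.2 - uxx p.1 p.2 - beta p.2 * ux p.1 p.2 + V p.1 p.2 * u p.1 p.2 =
  lambda * u p.1 p.2}.

Let w x t := u (clamp 0 1 x) (clamp a c t).
Let wx x t := ux (clamp 0 1 x) (clamp a c t).
Let b' (x t : R) := beta (clamp a c t).
Let q' x t := V (clamp 0 1 x) (clamp a c t) - lambda.
Let g x t := b' x t * wx x t - q' x t * w x t.

Let cw : continuous (fun p : R * R => w p.1 p.2).
Proof. by case: su => -[? _ _] _; exact: (continuous_clamp (ltW ac)). Qed.

Let cwx : continuous (fun p : R * R => wx p.1 p.2).
Proof. by case: su => -[_ ? _] _; exact: (continuous_clamp (ltW ac)). Qed.

Let cb' : continuous (fun p : R * R => b' p.1 p.2).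
Proof.
apply: (@continuous_clamp _ a c (fun _ t => beta t) (ltW ac)).
apply: continuous_subspaceT => p; apply: (@continuous_comp _ _ _ snd beta).
  exact: cvg_snd.
exact: cbeta.
Qed.

Let cq' : continuous (fun p : R * R => q' p.1 p.2).
Proof.
have c1 : continuous (fun p : R * R => V (clamp 0 1 p.1) (clamp a c p.2)).
  apply: (continuous_clamp (ltW ac)).
  by apply: continuous_subspaceW cV => p [].
by move=> p; apply: (@cvgB R R^o); [exact: c1|exact: cvg_cst].
Qed.

Let cg : continuous (fun p : R * R => g p.1 p.2).
Proof.
by move=> p; apply: (@cvgB R R^o); apply: (@cvgM R);
  [exact: cb'|exact: cwx|exact: cq'|exact: cw].
Qed.

Let dw y s : 0 < y < 1 -> is_derive y 1 (w ^~ s) (wx y s).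
Proof.
move=> y01; case: su => -[_ _ h] _.
have yI : y \in `[0, 1] by case/andP: y01 => ? ?; rewrite in_itv /= !ltW.
have := h y (clamp a c s) yI (clamp_itv _ (ltW ac)).
rewrite /wx (clamp_id yI); exact: (is_derive_within_clamp y01).
Qed.

Let flux_identity y x t : 0 < y -> y <= x -> x < 1 -> a <= t -> t < c ->
  time_primitive a wx x t - time_primitive a wx y t =
  time_primitive y (fun _ z => w z t - w z a - time_primitive a g z t) 0 x.
Proof.
move=> y0 yx x1 at_ tc; case: su => _ [iut iuxx hut huxx].
have aI : a \in `[a, c] by rewrite in_itv /= lexx ltW.
have tI : t \in `[a, c] by rewrite in_itv /= at_ ltW.
rewrite /time_primitive -RintegralB//; try exact: integrable_slice.
apply: (integrated_equation (c := c) (ut := ut) (uxx := uxx)) => //.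
- by move=> s; exact: continuous2_l.
- by move=> z; exact: continuous2_r.
- by move=> z; exact: continuous2_r.
- by move=> s; exact: continuous_time_primitive.
- apply: (ae_sub2 hut hut) => z hz _ z01 s r as_ sr rc.
  have zI : z \in `[0, 1] by exact: subset_itv_oo_cc z01.
  have sI : s \in `[a, c] by rewrite in_itv /= as_ (le_trans sr).
  have rI : r \in `[a, c] by rewrite in_itv /= rc (le_trans as_).
  by rewrite /w !clamp_id//; exact: hz.
- apply: (ae_sub2 huxx huxx) => s hs _ sac y' x' y'0 y'x' x'1.
  have sI : s \in `[a, c] by exact: subset_itv_oo_cc sac.
  have y'I : y' \in `[0, 1] by rewrite in_itv /= y'0 (le_trans y'x').
  have x'I : x' \in `[0, 1] by rewrite in_itv /= x'1 (le_trans y'0).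
  by rewrite /wx !clamp_id//; exact: hs.
- have FF := ae_filter_ringOfSetsType
    (@lebesgue_measure R \x @lebesgue_measure R)%E.
  apply: (@filterS _ _ FF) pde => -[z s] /= hzs z01 sac.
  have sI : s \in `[a, c] by exact: subset_itv_oo_cc sac.
  have zI : z \in `[0, 1] by exact: subset_itv_oo_cc z01.
  have := hzs z01 sac; rewrite /g /b' /q' /w /wx !clamp_id// => h.
  by rewrite mulrBl -h; ring.
Qed.

Let cF t : continuous (fun p : R * R => w p.2 t - w p.2 a - time_primitive a g p.2 t).
Proof.
have c1 : continuous (fun z => w z t - w z a - time_primitive a g z t).
  move=> z; apply: (@cvgB R R^o); last exact: continuous_time_primitive.
  by apply: (@cvgB R R^o); exact: continuous2_l.
move=> p; apply: (@continuous_comp _ _ _ snd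
  (fun z => w z t - w z a - time_primitive a g z t)).
  exact: cvg_snd.
exact: c1.
Qed.

Let is_derive_flux x t : 0 < x < 1 -> a <= t -> t < c ->
  is_derive x 1 (fun y => time_primitive a wx y t) (w x t - w x a - time_primitive a g x t).
Proof.
move=> /andP[x0 x1] at_ tc.
have h0 : 0 < x / 2 by lra.
have hx : x / 2 < x by lra.
have := @is_derive_time_primitive R (x / 2)
  (fun _ z => w z t - w z a - time_primitive a g z t) 0 x (@cF t) hx.
move=> /(is_derive_affine (- time_primitive a wx (x / 2) t) 1); rewrite mul1r.
have r0 : 0 < Num.min (x / 2) (1 - x) by rewrite lt_min h0 subr_gt0.
apply: is_derive_near r0 _ => y.
rewrite lt_min !ltr_norml => /andP[/andP[? ?] /andP[? ?]].
have xy : x / 2 <= y by lra.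
have y1 : y < 1 by lra.
by rewrite -(flux_identity h0 xy y1 at_ tc); ring.
Qed.

Let avg (k : R -> R -> R) d x t :=
  d^-1 * (time_primitive a k x (t + d) - time_primitive a k x t).

Let avg_near k : continuous (fun p : R * R => k p.1 p.2) ->
  forall e, 0 < e -> exists2 d0 : R, 0 < d0 & forall d x t, 0 < d -> d < d0 ->
    x \in `[0, 1] -> t \in `[a, c] -> a < t -> `|avg k d x t - k x t| < e.
Proof.
move=> ck e e0; have [d0 d00 hd] := heine 0 1 a c ck e0.
exists d0 => // d x t d1 dd0 xI tI at_.
have [s sI E] := time_primitive_mean x ck at_ d1.
rewrite /avg E mulrCA mulVf ?gt_eqF// mulr1; apply: hd => //.
  by rewrite subrr normr0.
by move: sI; rewrite in_itv /= => /andP[? ?]; rewrite ger0_norm; lra.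
Qed.

Let classical_on_avg d a' c' : 0 < d -> a < a' -> c' + d < c ->
  classical_on a' c' (avg w d) (avg wx d)
    (fun x t => d^-1 * ((w x (t + d) - w x a - time_primitive a g x (t + d)) -
                        (w x t - w x a - time_primitive a g x t)))
    (fun x t => d^-1 * (w x (t + d) - w x t)).
Proof.
move=> d0 aa' c'd; split.
- apply/within_continuous2P => x t [/= _]; rewrite in_itv /= => /andP[a't tc'].
  have at_ : a < t by exact: lt_le_trans a't.
  have atd : a < t + d by rewrite (lt_trans at_)// ltrDl.
  have /continuous_at2P h1 := @continuous2_time_primitive R a w x t cw at_.
  have /continuous_at2P h2 := @continuous2_time_primitive R a w x (t + d) cw atd.
  move=> e e0; have ed : 0 < e * d / 2 by rewrite divr_gt0// mulr_gt0.
  have [d1 d10 {}h1] := h1 _ ed; have [d2 d20 {}h2] := h2 _ ed.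
  exists (Num.min d1 d2); first by rewrite lt_min d10.
  move=> y s _; rewrite !lt_min => /andP[y1 y2] /andP[s1 s2].
  rewrite /avg -mulrBr normrM gtr0_norm ?invr_gt0// mulrC ltr_pdivrMr//.
  have sd : `|s + d - (t + d)| < d2 by have -> : s + d - (t + d) = s - t by ring.
  have := h1 y s y1 s1; have := h2 y (s + d) y2 sd.
  rewrite !ltr_norml => /andP[? ?] /andP[? ?]; apply/andP; split; lra.
- move=> t _; apply: continuous_subspaceT => x.
  apply: (@cvgM R); first exact: cvg_cst.
  by apply: (@cvgB R R^o); exact: continuous_time_primitive.
- move=> x t x01 /andP[a't tc'].
  have at_ : a < t by exact: lt_trans a't.
  have atd : a < t + d by rewrite (lt_trans at_)// ltrDl.
  have td : t + d < c by rewrite (le_lt_trans _ c'd)// lerD2r.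
  have tc : t < c by rewrite (lt_trans _ td)// ltrDl.
  split.
  + apply: is_deriveZ; apply: is_deriveB; apply: is_derive_time_primitive_param => //.
      by rewrite ltW.
    by move=> y s y01 _; exact: dw.
    by rewrite ltW.
    by move=> y s y01 _; exact: dw.
  + by apply: is_deriveZ; apply: is_deriveB; apply: is_derive_flux => //; rewrite ltW.
  + apply: is_deriveZ; apply: is_deriveB; last exact: is_derive_time_primitive.
    by apply: is_derive_shiftr; exact: is_derive_time_primitive.
Qed.

Lemma steklov_approx_solution :
  (forall t, t \in `[a, c] -> is_derive_within `[0, 1] (u ^~ t) 0 0 /\
                              is_derive_within `[0, 1] (u ^~ t) 1 0) ->
  approx_solution a c beta (fun x t => V x t - lambda) u.
Proof.
move=> neu.
have I0 : (0 : R) \in `[0, 1] by rewrite in_itv /= lexx ler01.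
have I1 : (1 : R) \in `[0, 1] by rewrite in_itv /= lexx ler01.
have wx0 t : t \in `[a, c] -> wx 0 t = 0 /\ wx 1 t = 0.
  move=> tI; have [n0 n1] := neu t tI; case: su => -[_ _ h] _.
  rewrite /wx !clamp_id//; split.
    exact: is_derive_within_unique I0 (h _ _ I0 tI) n0.
  exact: is_derive_within_unique I1 (h _ _ I1 tI) n1.
move=> a' c' e aa' a'c' c'c e0.
have [Mb Mb0 hb] := bounded_box (@ler01 R) (ltW ac) (continuous_subspaceT cb').
have [Mq Mq0 hq] := bounded_box (@ler01 R) (ltW ac) (continuous_subspaceT cq').
pose o := e / (1 + Mb + Mq).
have M1 : 0 < 1 + Mb + Mq by rewrite !addr_gt0.
have o0 : 0 < o by rewrite divr_gt0.
have oe : o <= e.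
  by rewrite ler_pdivrMr// ler_pMr// -addrA lerDl addr_ge0// ltW.
have [d1 d10 h1] := avg_near cw o0.
have [d2 d20 h2] := avg_near cwx o0.
have [d3 d30 h3] := avg_near cg o0.
pose d := Num.min (Num.min d1 (c - c')) (Num.min d2 d3) / 2.
have m0 : 0 < Num.min (Num.min d1 (c - c')) (Num.min d2 d3).
  by rewrite !lt_min d10 d20 d30 subr_gt0 c'c.
have d0 : 0 < d by rewrite divr_gt0.
have dm : d < Num.min (Num.min d1 (c - c')) (Num.min d2 d3).
  by rewrite ltr_pdivrMr// ltr_pMr// ltr1n.
have [[dd1 dcc] [dd2 dd3]] : (d < d1 /\ d < c - c') /\ d < d2 /\ d < d3.
  by move: dm; rewrite !lt_min => /andP[/andP[-> ->] /andP[-> ->]].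
have c'd : c' + d < c by lra.
exists (avg w d), (avg wx d), (fun x t => d^-1 *
    ((w x (t + d) - w x a - time_primitive a g x (t + d)) -
     (w x t - w x a - time_primitive a g x t))), (fun x t => d^-1 * (w x (t + d) - w x t)).
split; first exact: classical_on_avg.
move=> x t x01 /andP[a't tc'].
have at_ : a < t by exact: lt_le_trans a't.
have tI : t \in `[a, c] by rewrite in_itv /= (ltW at_) (le_trans tc' (ltW c'c)).
have xI : x \in `[0, 1] by rewrite in_itv.
have [w0 w1] := wx0 t tI.
split.
- rewrite (le_trans _ oe)//; have := h1 d x t d0 dd1 xI tI at_.
  have -> : w x t = u x t by rewrite /w !clamp_id.
  by move/ltW.
- by rewrite (le_trans _ oe)//; have := h2 d 0 t d0 dd2 I0 tI at_; rewrite w0 subr0 => /ltW.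
- by rewrite (le_trans _ oe)//; have := h2 d 1 t d0 dd2 I1 tI at_; rewrite w1 subr0 => /ltW.
- move=> _.
  have -> : beta t = b' x t by rewrite /b' clamp_id.
  have -> : V x t - lambda = q' x t by rewrite /q' !clamp_id.
  have -> : d^-1 * (w x (t + d) - w x t) - d^-1 *
      (w x (t + d) - w x a - time_primitive a g x (t + d) -
       (w x t - w x a - time_primitive a g x t)) -
      b' x t * avg wx d x t + q' x t * avg w d x t =
    (avg g d x t - g x t) - b' x t * (avg wx d x t - wx x t)
      + q' x t * (avg w d x t - w x t).
    have -> : g x t = b' x t * wx x t - q' x t * w x t by [].
    have -> : avg g d x t =
      d^-1 * (time_primitive a g x (t + d) - time_primitive a g x t) by [].
    ring.
  have H1 := ltW (h1 d x t d0 dd1 xI tI at_).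
  have H2 := ltW (h2 d x t d0 dd2 xI tI at_).
  have H3 := ltW (h3 d x t d0 dd3 xI tI at_).
  rewrite (le_trans (ler_normD _ _))//.
  have -> : e = (o + Mb * o) + Mq * o.
    have -> : o + Mb * o + Mq * o = o * (1 + Mb + Mq) by ring.
    by rewrite /o divfK// gt_eqF.
  rewrite lerD//; last by rewrite normrM ler_pM// hq.
  rewrite (le_trans (ler_normB _ _))// lerD//.
  by rewrite normrM ler_pM// hb.
Qed.

End steklov.

(** The averages [avg w d] have x-derivative [avg wx d], whose own x-derivative
    follows from [integrated_equation].  Applying the operator to them leaves the
    difference between the average of the lower order terms and these terms at
    (x, t), which uniform continuity makes small. *)
Lemma strong_solution_approx a c lambda beta V u : a < c -> continuous beta ->
  {within `[0, 1] `*` [set: R], continuous (fun p : R * R => V p.1 p.2)} ->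
  strong_solution a c beta V u (fun x t => lambda * u x t) ->
  (forall t, t \in `[a, c] -> is_derive_within `[0, 1] (u ^~ t) 0 0 /\
                              is_derive_within `[0, 1] (u ^~ t) 1 0) ->
  approx_solution a c beta (fun x t => V x t - lambda) u.
Proof.
move=> ac cb cV [ux [ut [uxx [su pde]]]].
exact: (steklov_approx_solution ac cb cV su pde).
Qed.

End approximation.

(** * The classical maximum principle *)
Section maximum_principle.
Variable R : realType.
Implicit Types (a c k lambda x t y s : R) (u v q f V : R -> R -> R) (beta : R -> R).

Lemma is_derive_exp_affine k s t :
  is_derive t 1 (fun t => expR (k * (t - s))) (k * expR (k * (t - s))).
Proof.
have h : is_derive t 1 (fun t => k * (t - s)) (k * 1).
  by apply: is_derive_affine; exact: is_derive_id.
have -> : k * expR (k * (t - s)) = expR (k * (t - s)) * (k * 1).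
  by rewrite mulr1 mulrC.
exact: (@is_derive1_comp _ expR (fun t => k * (t - s)) t).
Qed.

Lemma within_slice (J : set R) v t : J t ->
  {within `[0, 1] `*` J, continuous (fun p : R * R => v p.1 p.2)} ->
  {within `[0, 1], continuous (v ^~ t)}.
Proof.
move=> Jt /within_continuous2P cv; apply/subspace_continuousP => x x01.
apply/cvgrPdist_lt => e e0; rewrite near_withinE.
have Q y : `[0, 1]%classic y -> (`[0, 1] `*` J) (y, t) by split.
have [d d0 hd] := cv _ _ (Q x x01) _ e0.
apply/nbhs_ballP; exists d => // y; rewrite /ball /= => xy yI.
rewrite distrC; apply: hd; [exact: Q|by rewrite distrC|by rewrite subrr normr0].
Qed.

Lemma interior_max_test (w wx : R -> R) (wxx x r : R) : 0 < r ->
  (forall y, `|y - x| < r -> is_derive y 1 w (wx y)) ->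
  is_derive x 1 wx wxx ->
  (forall y, `|y - x| < r -> w y <= w x) -> wx x = 0 /\ wxx <= 0.
Proof.
move=> r0 dw dwx wm.
have dwx0 : is_derive x 1 w (wx x) by apply: dw; rewrite subrr normr0.
have wx0 : wx x = 0.
  apply/eqP; rewrite eq_le; apply/andP; split.
    apply: (is_derive_max_right r0 dwx0) => y /andP[? ?]; apply: wm.
    by rewrite ger0_norm; lra.
  apply: (is_derive_max_left r0 dwx0) => y /andP[? ?]; apply: wm.
  by rewrite ler0_norm; lra.
split=> //; rewrite leNgt; apply/negP => p.
have [|d d0 hd] := (is_deriveP _ _ _).1 dwx (wxx / 2); first by lra.
pose m := Num.min d r / 2.
have m0 : 0 < Num.min d r by rewrite lt_min d0.
have [md mr] : Num.min d r <= d /\ Num.min d r <= r by rewrite !ge_min !lexx orbT.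
have xm : x < x + m by rewrite ltrDl divr_gt0.
have mE : m = Num.min d r / 2 by [].
have dI y : y \in `[x, x + m] -> is_derive y 1 w (wx y).
  by rewrite in_itv /= => /andP[? ?]; apply: dw; rewrite ger0_norm; lra.
have [y yI E] := MVT xm (fun y yI => dI y (subset_itv_oo_cc yI))
  (derivable_within_continuous (fun y yI => let: DeriveDef d _ := dI y yI in d)).
move: yI; rewrite in_itv /= => /andP[xy ym].
have : `|y - x| < d by rewrite gtr0_norm; lra.
move=> /hd; rewrite wx0 subr0 ler_norml gtr0_norm ?subr_gt0// => /andP[h _].
have wy : 0 < wx y.
  have : 0 < wxx / 2 * (y - x) by rewrite mulr_gt0// ?subr_gt0//; lra.
  by lra.
have := wm (x + m); rewrite addrAC subrr add0r gtr0_norm ?divr_gt0//.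
have {}E : w (x + m) = w x + wx y * m by rewrite -(subrK (w x) (w (x + m))) E; ring.
have : 0 < wx y * m by rewrite mulr_gt0// divr_gt0.
move=> ? H; have : w (x + m) <= w x by apply: H; lra.
by lra.
Qed.

(** A strict sign of the derivative at an end of [0,1] plays the role of Hopf's
    lemma; the comparison barrier is built to produce such signs. *)
Lemma not_max_left (w wx : R -> R) :
  {within `[0, 1], continuous w} -> {within `[0, 1], continuous wx} ->
  (forall x, 0 < x < 1 -> is_derive x 1 w (wx x)) -> 0 < wx 0 ->
  exists2 x, 0 <= x <= 1 & w 0 < w x.
Proof.
move=> cw cwx dw w0.
have I0 : `[0, 1]%classic (0 : R) by rewrite /= in_itv /= lexx ler01.
have /subspace_continuousP/(_ 0 I0)/cvgrPdist_lt/(_ _ w0) := cwx.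
rewrite near_withinE => /nbhs_ballP[d /= d0 hd].
pose y := Num.min d 1 / 2.
have m0 : 0 < Num.min d 1 by rewrite lt_min d0 ltr01.
have [md m1] : Num.min d 1 <= d /\ Num.min d 1 <= 1 by rewrite !ge_min !lexx orbT.
have yE : y = Num.min d 1 / 2 by [].
have y0 : 0 < y by lra.
have [||z zI E] := @MVT R w wx 0 y y0.
- move=> z; rewrite in_itv /= => /andP[? ?]; apply: dw; apply/andP; split; lra.
- apply: continuous_subspaceW cw => z /=; rewrite !in_itv /= => /andP[? ?].
  by apply/andP; split; lra.
exists y; first by apply/andP; split; lra.
move: zI; rewrite in_itv /= => /andP[z0 zy].
have : 0 < wx z.
  have zd : ball 0 d z by rewrite /ball /= sub0r normrN gtr0_norm; lra.
  have zI : `[0, 1]%classic z by rewrite /= in_itv /=; apply/andP; split; lra.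
  have := le_lt_trans (ler_norm _) (hd z zd zI).
  by rewrite ltrBlDr ltrDl.
move=> /mulr_gt0/(_ y0); move: E; rewrite subr0; lra.
Qed.

Lemma within_reflect (w : R -> R) :
  {within `[0, 1], continuous w} -> {within `[0, 1], continuous (fun x => w (1 - x))}.
Proof.
move=> /subspace_continuousP cw; apply/subspace_continuousP => x x01.
have I y : `[0, 1]%classic y -> `[0, 1]%classic (1 - y).
  by rewrite /= !in_itv /= => /andP[? ?]; apply/andP; split; lra.
apply/cvgrPdist_lt => e e0; rewrite near_withinE.
have /cvgrPdist_lt/(_ _ e0) := cw _ (I _ x01).
rewrite near_withinE => /nbhs_ballP[d /= d0 hd].
apply/nbhs_ballP; exists d => // y; rewrite /ball /= => xy yI.
apply: hd; last exact: I.
rewrite /ball /=; have -> : 1 - x - (1 - y) = y - x by ring.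
by rewrite distrC.
Qed.

Lemma is_derive_reflect (w : R -> R) (x l : R) : is_derive (1 - x) 1 w l ->
  is_derive x 1 (fun y => w (1 - y)) (- l).
Proof.
move=> dw.
have h : is_derive x 1 (fun y : R => 1 - y) (0 - 1).
  by apply: is_deriveB.
have -> : - l = l * (0 - 1) by ring.
exact: (@is_derive1_comp _ w (fun y => 1 - y) x).
Qed.

Lemma not_max_right (w wx : R -> R) :
  {within `[0, 1], continuous w} -> {within `[0, 1], continuous wx} ->
  (forall x, 0 < x < 1 -> is_derive x 1 w (wx x)) -> wx 1 < 0 ->
  exists2 x, 0 <= x <= 1 & w 1 < w x.
Proof.
move=> cw cwx dw w0.
have [||||x x01] := @not_max_left (fun x => w (1 - x)) (fun x => - wx (1 - x)).
- exact: within_reflect.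
- by move=> x; apply: (@cvgN R R^o); exact: within_reflect.
- move=> x /andP[? ?]; apply: is_derive_reflect; apply: dw.
  by apply/andP; split; lra.
- by rewrite subr0 oppr_gt0.
rewrite subr0 => h; exists (1 - x) => //.
by move: x01 => /andP[? ?]; apply/andP; split; lra.
Qed.

(** The differential inequality is needed only where exp (- Lam (t - a)) v attains
    a positive maximum over the box: there v_x = 0 and v_xx <= 0, while maximality
    in t forces v_t >= Lam v. *)
Lemma max_principle a c (Lam : R) (v vx vxx vt : R -> R -> R) : a <= c ->
  classical_on a c v vx vxx vt ->
  (forall x, 0 <= x <= 1 -> v x a <= 0) ->
  (forall t, a < t <= c -> 0 < vx 0 t /\ vx 1 t < 0) ->
  (forall x t, 0 < x < 1 -> a < t <= c -> 0 < v x t -> vx x t = 0 ->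
     vxx x t <= 0 -> vt x t < Lam * v x t) ->
  forall x t, 0 <= x <= 1 -> a <= t <= c -> v x t <= 0.
Proof.
move=> ac [cv cvx dv] va bd pde x1 t1 x1I t1I; rewrite leNgt; apply/negP => vp.
pose E t := expR (- Lam * (t - a)).
have E0 t : 0 < E t by exact: expR_gt0.
have cE : continuous (fun p : R * R => E p.2).
  move=> p; apply: (@continuous_comp _ _ _ snd E); first exact: cvg_snd.
  by apply: differentiable_continuous; apply/derivable1_diffP;
    have [] := is_derive_exp_affine (- Lam) a p.2.
have cf : {within `[0, 1] `*` `[a, c],
    continuous (fun p : R * R => E p.2 * v p.1 p.2)}.
  have cE' : {within `[0, 1] `*` `[a, c], continuous (fun p : R * R => E p.2)}.
    exact: continuous_subspaceT.
  by move=> p; apply: (@cvgM R); [exact: cE'|exact: cv].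
have K0 : (`[0, 1] `*` `[a, c] : set (R * R)) !=set0.
  by exists (0, a); split; rewrite /= in_itv /= lexx ?ler01.
have cK : compact (`[0, 1] `*` `[a, c] : set (R * R)).
  by apply: compact_setX; exact: segment_compact.
have [[x0 t0] /set_mem [/= xI tI] hm] := compact_EVT_max K0 cK cf.
rewrite in_itv /= in xI; rewrite in_itv /= in tI.
have {}hm x t : 0 <= x <= 1 -> a <= t <= c -> E t * v x t <= E t0 * v x0 t0.
  move=> xI' tI'; apply: (hm (x, t)); rewrite inE; split; rewrite /= in_itv //=.
have v0 : 0 < v x0 t0.
  by rewrite -(pmulr_rgt0 _ (E0 t0)) (lt_le_trans _ (hm _ _ x1I t1I))// mulr_gt0.
have hx x : 0 <= x <= 1 -> v x t0 <= v x0 t0.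
  by move=> h; rewrite -(ler_pM2l (E0 t0)) hm.
have at0 : a < t0 <= c.
  case/andP: (tI) => at0 ->; rewrite andbT lt_neqAle at0 andbT.
  by apply/eqP => h; move: v0; rewrite ltNge -h va.
have cvt := within_slice tI cv.
have dvt x (h : 0 < x < 1) : is_derive x 1 (v ^~ t0) (vx x t0) by have [] := dv x t0 h at0.
have x01 : 0 < x0 < 1.
  case/andP: (xI) => h0 h1; rewrite !lt_neqAle h0 h1 !andbT.
  apply/andP; split; apply/eqP => h.
    have [x xI' ] := not_max_left cvt (cvx _ tI) dvt (bd _ at0).1.
    by rewrite h ltNge hx.
  have [x xI' ] := not_max_right cvt (cvx _ tI) dvt (bd _ at0).2.
  by rewrite -h ltNge hx.
have [_ dvx dtt] := dv _ _ x01 at0.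
have r0 : 0 < Num.min x0 (1 - x0).
  by case/andP: x01 => ? ?; rewrite lt_min; apply/andP; split; lra.
have rI y : `|y - x0| < Num.min x0 (1 - x0) -> 0 < y < 1.
  rewrite lt_min !ltr_norml => /andP[/andP[? ?] /andP[? ?]].
  by apply/andP; split; lra.
have hx' y : `|y - x0| < Num.min x0 (1 - x0) -> v y t0 <= v x0 t0.
  by move=> /rI /andP[? ?]; apply: hx; rewrite !ltW.
have [vx0 vxx0] := interior_max_test r0 (fun y h => dvt y (rI y h)) dvx hx'.
have := pde _ _ x01 at0 v0 vx0 vxx0; apply/negP; rewrite -leNgt.
have dE := is_derive_mul (is_derive_exp_affine (- Lam) a t0) dtt.
have rt : 0 < t0 - a by case/andP: at0 => ? _; rewrite subr_gt0.
have h0 y : t0 - (t0 - a) < y < t0 -> E y * v x0 y <= E t0 * v x0 t0.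
  case/andP: at0 => ? ? /andP[? ?]; apply: hm => //; apply/andP; split; lra.
have := is_derive_max_left rt dE h0; rewrite -/(E t0).
have -> : - Lam * E t0 * v x0 t0 + E t0 * vt x0 t0 =
  E t0 * (vt x0 t0 - Lam * v x0 t0) by ring.
by rewrite pmulr_rge0// subr_ge0.
Qed.

End maximum_principle.

(** * Stability of approximability *)
Section closure_properties.
Variable R : realType.
Implicit Types (a c lambda x t y s : R) (u v q f V : R -> R -> R) (beta : R -> R).

Lemma classical_onD a c v vx vxx vt u ux uxx ut :
  classical_on a c v vx vxx vt -> classical_on a c u ux uxx ut ->
  classical_on a c (fun x t => v x t + u x t) (fun x t => vx x t + ux x t)
    (fun x t => vxx x t + uxx x t) (fun x t => vt x t + ut x t).
Proof.
move=> [cv cvx dv] [cu cux du]; split.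
- by move=> p; apply: (@cvgD R R^o); [exact: cv|exact: cu].
- by move=> t tI x; apply: (@cvgD R R^o); [exact: cvx|exact: cux].
- move=> x t xI tI; have [v1 v2 v3] := dv x t xI tI.
  have [u1 u2 u3] := du x t xI tI.
  by split; exact: is_deriveD.
Qed.

Lemma classical_on_scale a c (k k' : R -> R) v vx vxx vt :
  (forall t, a <= t <= c -> is_derive t 1 k (k' t)) ->
  classical_on a c v vx vxx vt ->
  classical_on a c (fun x t => k t * v x t) (fun x t => k t * vx x t)
    (fun x t => k t * vxx x t) (fun x t => k' t * v x t + k t * vt x t).
Proof.
move=> dk [cv cvx dv]; split.
- have ck : {within `[0, 1] `*` `[a, c], continuous (fun p : R * R => k p.2)}.
    apply: (within_continuous2P _ (fun _ t => k t)).2 => x t [_ /=]; rewrite in_itv /= => tI e e0.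
    have : {for t, continuous k}.
      apply: differentiable_continuous; apply/derivable1_diffP.
      by have [] := dk t tI.
    move=> /cvgrPdist_lt/(_ _ e0)/nbhs_ballP[d /= d0 hd].
    exists d => // y s _ _ st; rewrite distrC; apply: hd.
    by rewrite /ball /= distrC.
  by move=> p; apply: (@cvgM R); [exact: ck|exact: cv].
- by move=> t tI x; apply: (@cvgM R); [exact: cvg_cst|exact: cvx].
- move=> x t xI /andP[at_ tc]; have [|v1 v2 v3] := dv x t xI; first by rewrite at_.
  split; [exact: is_deriveZ|exact: is_deriveZ|].
  by apply: is_derive_mul v3; apply: dk; rewrite (ltW at_).
Qed.

Lemma classical_on_space a c (p p' p'' : R -> R) :
  (forall x, is_derive x 1 p (p' x)) -> (forall x, is_derive x 1 p' (p'' x)) ->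
  classical_on a c (fun x _ => p x) (fun x _ => p' x) (fun x _ => p'' x)
    (fun _ _ => 0).
Proof.
move=> dp dp'.
have cd (g : R -> R) (g' : R -> R) : (forall x, is_derive x 1 g (g' x)) -> continuous g.
  move=> dg x; apply: differentiable_continuous; apply/derivable1_diffP.
  by have [] := dg x.
split.
- apply: continuous_subspaceT => w.
  apply: (@continuous_comp _ _ _ fst p); first exact: cvg_fst.
  exact: cd dp _.
- by move=> t _; apply: continuous_subspaceT; exact: cd dp'.
- by move=> x t _ _; split => //; exact: is_derive_cst.
Qed.

Lemma is_derive_inv (g : R -> R) (x l : R) : g x != 0 -> is_derive x 1 g l ->
  is_derive x 1 (fun y => (g y)^-1) (- l * (g x)^-1 ^+ 2).
Proof.
move=> gx dg; have := is_deriveV gx dg.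
by rewrite /GRing.scale /= mulNr mulrC -mulNr exprVn.
Qed.

Lemma classical_on_inv a c v vx vxx vt :
  (forall x t, 0 <= x <= 1 -> a <= t <= c -> 0 < v x t) ->
  classical_on a c v vx vxx vt ->
  classical_on a c (fun x t => (v x t)^-1) (fun x t => - vx x t * (v x t)^-1 ^+ 2)
    (fun x t => - vxx x t * (v x t)^-1 ^+ 2 + 2 * vx x t ^+ 2 * (v x t)^-1 ^+ 3)
    (fun x t => - vt x t * (v x t)^-1 ^+ 2).
Proof.
move=> v0 [cv cvx dv]; split.
- apply/subspace_continuousP => -[x t] [/= xI tI]; rewrite !in_itv /= in xI tI.
  apply: (@cvgV R); first by rewrite /= gt_eqF ?v0.
  have /subspace_continuousP := cv; apply.
  by split; rewrite /= in_itv.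
- move=> t tI; apply/subspace_continuousP => x /= xI; rewrite in_itv /= in xI.
  have xI' : `[0, 1]%classic x by rewrite /= in_itv.
  have /subspace_continuousP/(_ x xI') c1 := cvx t tI.
  have /subspace_continuousP/(_ x xI') c2 := within_slice tI cv.
  apply: (@cvgM R); first exact: (@cvgN R R^o).
  have c3 : (v y t)^-1 @[y --> within `[0, 1] (nbhs x)] --> (v x t)^-1.
    by apply: (@cvgV R) => //; rewrite gt_eqF ?v0.
  exact: (@cvgM R).
- move=> x t xI tI; have [d1 d2 d3] := dv x t xI tI.
  have xI' : 0 <= x <= 1 by case/andP: xI => ? ?; rewrite !ltW.
  have tI' : a <= t <= c by case/andP: tI => ? ->; rewrite ltW.
  have vN : v x t != 0 by rewrite gt_eqF// v0.
  split; [exact: (is_derive_inv vN d1)| |exact: (is_derive_inv vN d3)].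
  have di := is_derive_inv vN d1.
  have dn := is_deriveN d2.
  have D := is_derive_mul dn (is_derive_mul di di).
  set l := (X in is_derive _ _ _ X).
  have -> : l = - vxx x t * ((v x t)^-1 * (v x t)^-1) + (- vx x t) *
      (- vx x t * (v x t)^-1 ^+ 2 * (v x t)^-1
       + (v x t)^-1 * (- vx x t * (v x t)^-1 ^+ 2)).
    by rewrite /l; ring.
  exact: D.
Qed.

Lemma approx_solution_sub a c beta q u : approx_solution a c beta q u ->
  approx_subsolution a c beta q u /\ approx_subsolution a c beta q (fun x t => - u x t).
Proof.
move=> h; split=> a' c' e aa' a'c' c'c e0.
  have [v [vx [vxx [vt [cl hv]]]]] := h a' c' e aa' a'c' c'c e0.
  exists v, vx, vxx, vt; split => // x t xI tI; have [h1 h2 h3 h4] := hv x t xI tI.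
  split => //; first by move: h2; rewrite ler_norml => /andP[].
    by rewrite (le_trans (ler_norm _)).
  by move=> /h4; apply: le_trans; exact: ler_norm.
have [v [vx [vxx [vt [cl hv]]]]] := h a' c' e aa' a'c' c'c e0.
have clN := classical_on_scale (k := fun=> -1) (fun t _ => is_derive_cst (-1 : R) t 1) cl.
exists (fun x t => -1 * v x t), (fun x t => -1 * vx x t), (fun x t => -1 * vxx x t),
  (fun x t => 0 * v x t + -1 * vt x t).
split=> // x t xI tI; have [h1 h2 h3 h4] := hv x t xI tI; split => //.
- by rewrite mulN1r -opprD normrN.
- by rewrite mulN1r lerN2 (le_trans (ler_norm _)).
- by rewrite mulN1r; move: h3; rewrite ler_norml lerNl => /andP[].
- move=> /h4; rewrite ler_norml lerNl => /andP[+ _]; apply: le_trans.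
  by rewrite le_eqVlt; apply/orP; left; apply/eqP; ring.
Qed.

Lemma approx_subsolutionD a c beta q u w :
  approx_subsolution a c beta q u -> approx_subsolution a c beta q w ->
  approx_subsolution a c beta q (fun x t => u x t + w x t).
Proof.
move=> hu hw a' c' e aa' a'c' c'c e0.
have e20 : 0 < e / 2 by rewrite divr_gt0.
have [v [vx [vxx [vt [cl hv]]]]] := hu a' c' _ aa' a'c' c'c e20.
have [z [zx [zxx [zt [clz hz]]]]] := hw a' c' _ aa' a'c' c'c e20.
exists (fun x t => v x t + z x t), (fun x t => vx x t + zx x t),
  (fun x t => vxx x t + zxx x t), (fun x t => vt x t + zt x t).
split; first exact: classical_onD.
move=> x t xI tI; have [h1 h2 h3 h4] := hv x t xI tI.
have [k1 k2 k3 k4] := hz x t xI tI; split.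
- rewrite [leRHS]splitr opprD addrACA (le_trans (ler_normD _ _))//.
  by rewrite lerD.
- by rewrite [X in - X]splitr opprD lerD.
- by rewrite [leRHS]splitr lerD.
- move=> x01; have := h4 x01; have := k4 x01; rewrite !mulrDr; lra.
Qed.

(** This compares solutions belonging to different spectral parameters: a factor
    exp (m (t - a)) amounts to subtracting m from the potential. *)
Lemma approx_subsolution_exp a c (k m : R) beta q u : 0 < k -> a < c ->
  approx_subsolution a c beta q u ->
  approx_subsolution a c beta (fun x t => q x t - m)
    (fun x t => k * expR (m * (t - a)) * u x t).
Proof.
move=> k0 ac hu a' c' e aa' a'c' c'c e0.
pose g t := k * expR (m * (t - a)).
have g0 t : 0 < g t by rewrite mulr_gt0// expR_gt0.
pose G := k * expR (`|m| * (c - a)).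
have G0 : 0 < G by rewrite mulr_gt0// expR_gt0.
have gG t : a' <= t <= c' -> g t <= G.
  move=> /andP[? ?]; rewrite ler_pM2l// ler_expR.
  rewrite (le_trans (ler_norm _))// normrM ler_wpM2l//.
  by rewrite ger0_norm; lra.
have e10 : 0 < e / G by rewrite divr_gt0.
have [v [vx [vxx [vt [cl hv]]]]] := hu a' c' _ aa' a'c' c'c e10.
have dg t : a' <= t <= c' -> is_derive t 1 g (m * g t).
  move=> _; have -> : m * g t = k * (m * expR (m * (t - a))) by rewrite /g; ring.
  exact: is_deriveZ (is_derive_exp_affine m a t).
exists (fun x t => g t * v x t), (fun x t => g t * vx x t),
  (fun x t => g t * vxx x t), (fun x t => m * g t * v x t + g t * vt x t).
split; first exact: classical_on_scale.
have ge t r : a' <= t <= c' -> r <= e / G -> g t * r <= e.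
  move=> tI re; have [r0|r0] := leP 0 r.
    by rewrite (le_trans (ler_pM _ _ (gG t tI) re))// ?(ltW (g0 _))// mulrC divfK ?gt_eqF.
  by rewrite (@le_trans _ _ 0) ?(ltW e0)// mulr_ge0_le0// ltW.
move=> x t xI tI; have [h1 h2 h3 h4] := hv x t xI tI; split.
- by rewrite -mulrBr normrM gtr0_norm// ge.
- by rewrite lerNl -mulrN ge// lerNl.
- exact: ge.
- move=> x01; have := ge t _ tI (h4 x01); apply: le_trans.
  by rewrite le_eqVlt; apply/orP; left; apply/eqP; ring.
Qed.

End closure_properties.

(** * The comparison principle *)
Section comparison.
Variable R : realType.
Implicit Types (a c lambda x t y s : R) (u v q f V : R -> R -> R) (beta : R -> R).

Lemma classical_subsolution a c beta q u ux uxx ut :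
  classical_on a c u ux uxx ut ->
  (forall x t, 0 <= x <= 1 -> a < t < c -> [/\ 0 <= ux 0 t, ux 1 t <= 0
     & 0 < x < 1 -> ut x t - uxx x t - beta t * ux x t + q x t * u x t <= 0]) ->
  approx_subsolution a c beta q u.
Proof.
move=> [cu cux du] hu a' c' e aa' a'c' c'c e0.
exists u, ux, uxx, ut; split.
  split.
  - apply: continuous_subspaceW cu => -[x t] [/= xI]; rewrite ?in_itv /= => /andP[? ?].
    split => //=.
    by apply/andP; split; [apply: le_trans (ltW aa') _|apply: le_trans (ltW c'c)].
  - by move=> t /andP[? ?]; apply: cux; apply/andP; split; lra.
  - by move=> x t xI /andP[? ?]; apply: du => //; apply/andP; split; lra.
move=> x t xI /andP[a't tc'].
have [|h1 h2 h3] := hu x t xI; first by apply/andP; split; lra.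
split.
- by rewrite subrr normr0 ltW.
- by rewrite (le_trans _ h1)// oppr_le0 ltW.
- by rewrite (le_trans h2)// ltW.
- by move=> /h3 h; rewrite (le_trans h)// ltW.
Qed.

(** An approximation v of u with error d is compared with d S, where
    S = exp (K (t - a')) (2 + 2 (x - 1/2)^2).  The slope of S at the ends beats the
    boundary error, its size the initial error, and its growth rate K the error in
    the equation together with the bounded drift and potential. *)
Lemma comparison a c (Mb Mq : R) beta q u : a < c -> 0 <= Mb -> 0 <= Mq ->
  (forall t, a <= t <= c -> `|beta t| <= Mb) ->
  (forall x t, 0 <= x <= 1 -> a <= t <= c -> `|q x t| <= Mq) ->
  {within `[0, 1] `*` `[a, c], continuous (fun p : R * R => u p.1 p.2)} ->
  approx_subsolution a c beta q u ->
  (forall x, 0 <= x <= 1 -> u x a <= 0) ->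
  forall x t, 0 <= x <= 1 -> a <= t <= c -> u x t <= 0.
Proof.
move=> ac Mb0 Mq0 hb hq cu su ua.
have cu' := continuous_clamp (ltW ac) cu.
pose K := 3 + Mb + 3 * Mq.
have K0 : 0 < K by rewrite /K; lra.
pose C := 1 + 3 * expR (K * (c - a)).
have C0 : 0 < C by rewrite addr_gt0// mulr_gt0// expR_gt0.
(* a' < t0 is chosen so close to a that u <= d at time a' *)
have main x0 t0 : 0 <= x0 <= 1 -> a < t0 < c -> u x0 t0 <= 0.
  move=> x0I /andP[at0 t0c]; apply/ler_addgt0Pr => e e0; rewrite add0r.
  pose d := e / C.
  have d0 : 0 < d by rewrite divr_gt0.
  have [a' [aa' a't0 ua']] : exists a', [/\ a < a', a' < t0 &
      forall x, 0 <= x <= 1 -> u x a' <= d].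
    have [r r0 hr] := @heine R 0 1 a c (fun x t => u (clamp 0 1 x) (clamp a c t)) cu' _ d0.
    pose m := Num.min r (t0 - a) / 2.
    have m0 : 0 < Num.min r (t0 - a) by rewrite lt_min r0 subr_gt0.
    have [m1 m2] : Num.min r (t0 - a) <= r /\ Num.min r (t0 - a) <= t0 - a.
      by rewrite !ge_min !lexx orbT.
    have mE : m = Num.min r (t0 - a) / 2 by [].
    exists (a + m); split; [lra|lra|move=> x xI].
    have xI' : x \in `[0, 1] by rewrite in_itv.
    have aI : a \in `[a, c] by rewrite in_itv /= lexx ltW.
    have amI : a + m \in `[a, c] by rewrite in_itv /=; apply/andP; split; lra.
    have := hr x a xI' aI x (a + m); rewrite subrr normr0 => /(_ r0).
    have -> : a + m - a = m by ring.
    rewrite gtr0_norm; last by lra.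
    rewrite !clamp_id// => h.
    have : u x (a + m) - u x a < d by apply: le_lt_trans (ler_norm _) (h _); lra.
    by have := ua x xI; lra.
  have [v [vx [vxx [vt [cl hv]]]]] := su a' t0 d aa' a't0 t0c d0.
  pose E t := expR (K * (t - a')).
  have E0 t : 0 < E t by exact: expR_gt0.
  pose p x := 2 + 2 * ((x - 1 / 2) * (x - 1 / 2)).
  have E1 t : a' <= t -> 1 <= E t.
    by move=> h; rewrite /E -expR0 ler_expR mulr_ge0 ?subr_ge0// ltW.
  have dp x : is_derive x 1 p (4 * (x - 1 / 2)).
    have h1 : is_derive x 1 (fun x : R => x - 1 / 2) (1 - 0) by exact: is_deriveB.
    have -> : 4 * (x - 1 / 2) = 0 + 2 * ((1 - 0) * (x - 1 / 2) + (x - 1 / 2) * (1 - 0)) by ring.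
    by apply: is_deriveD; apply: is_deriveZ; exact: (is_derive_mul h1 h1).
  have dp' x : is_derive x 1 (fun x : R => 4 * (x - 1 / 2)) 4.
    by rewrite -[X in is_derive _ _ _ X]mulr1; apply: is_derive_affine; exact: is_derive_id.
  have dE t : a' <= t <= t0 -> is_derive t 1 E (K * E t).
    by move=> _; exact: is_derive_exp_affine.
  have clS := classical_on_scale dE (classical_on_space a' t0 dp dp').
  have clS' := classical_on_scale (k := fun=> - d) (fun t _ => is_derive_cst (- d : R) t 1) clS.
  have clw := classical_onD cl clS'.
  have pb x : 0 <= x <= 1 -> 2 <= p x <= 3.
    move=> /andP[x0' x1']; rewrite /p.
    have h1 : 0 <= (x - 1 / 2) * (x - 1 / 2) by rewrite -expr2 sqr_ge0.
    have h2 : 0 <= x * (1 - x) by rewrite mulr_ge0// subr_ge0.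
    have h3 : (x - 1 / 2) * (x - 1 / 2) = 1 / 4 - x * (1 - x) by field.
    by apply/andP; split; lra.
  have tac t : a' <= t <= t0 -> a <= t <= c.
    by move=> /andP[? ?]; apply/andP; split; lra.
  have Ed t : a' <= t -> d <= d * E t by move=> h; rewrite ler_pMr// E1.
  have wle := max_principle (Lam := Mq) (ltW a't0) clw.
  have {}wle : forall x t, 0 <= x <= 1 -> a' <= t <= t0 ->
      v x t + - d * (E t * p x) <= 0.
    have I0 : 0 <= (0 : R) <= 1 by rewrite lexx ler01.
    apply: wle.
    - move=> x xI; have [|h _ _ _] := hv x a' xI; first by rewrite lexx ltW.
      have := ua' x xI; have /andP[? _] := pb x xI.
      have -> : E a' = 1 by rewrite /E subrr mulr0 expR0.
      move: h; rewrite ler_norml => /andP[_ h] h'.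
      have : d * 2 <= d * p x by rewrite ler_pM2l.
      by lra.
    - move=> t /andP[? ?]; have [|_ h1 h2 _] := hv 0 t I0.
        by apply/andP; split; lra.
      by have := Ed t; split; lra.
    - move=> x t xI tI wp wx0 wxx0.
      have xI' : 0 <= x <= 1 by case/andP: xI => ? ?; rewrite !ltW.
      have tI' : a' <= t <= t0 by case/andP: tI => ? ->; rewrite ltW.
      have [_ _ _ /(_ xI) hpde] := hv x t xI' tI'.
      have /andP[p1 p2] := pb x xI'.
      have hbt := hb t (tac t tI'); have hqt := hq x t xI' (tac t tI').
      set vv := v x t in wp hpde *; set S := E t * p x in wp *.
      have vE : vv = (vv + - d * S) + d * S by ring.
      have vxE : vx x t = d * (E t * (4 * (x - 1 / 2))) by lra.
      have q1 : - (q x t * vv) <= Mq * (vv + - d * S) + Mq * (3 * (d * E t)).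
        have vv0 : 0 <= vv.
          have p0 : 0 <= p x by lra.
          rewrite vE; apply: addr_ge0; first exact: ltW.
          by rewrite mulr_ge0 ?(ltW d0)// mulr_ge0// ltW.
        rewrite -mulNr (@le_trans _ _ (Mq * vv))//.
          by rewrite ler_wpM2r// (le_trans (ler_norm _))// normrN.
        rewrite {1}vE mulrDr lerD2l ler_wpM2l//.
        have -> : d * S = d * E t * p x by rewrite /S; ring.
        have -> : 3 * (d * E t) = d * E t * 3 by ring.
        by rewrite ler_pM2l// mulr_gt0.
      have b1 : beta t * vx x t <= Mb * (2 * (d * E t)).
        rewrite (le_trans (ler_norm _))// normrM ler_pM// vxE.
        have -> : d * (E t * (4 * (x - 1 / 2))) = (d * E t) * (4 * (x - 1 / 2)) by ring.
        have dE0 : 0 < d * E t by rewrite mulr_gt0.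
        rewrite normrM (gtr0_norm dE0) mulrC ler_pM2r//.
        by case/andP: xI => ? ?; rewrite ler_norml; apply/andP; split; lra.
      have k1 : 2 * (K * (d * E t)) <= K * (d * S).
        have -> : K * (d * S) = p x * (K * (d * E t)) by rewrite /S; ring.
        by rewrite (ler_pM2r (mulr_gt0 K0 (mulr_gt0 d0 (E0 t)))).
      have [Edt _] : d <= d * E t /\ True by split=> //; apply: Ed; case/andP: tI'.
      have KE : K * (d * E t) = 3 * (d * E t) + Mb * (d * E t) + 3 * Mq * (d * E t).
        by rewrite /K; ring.
      have dE0 : 0 < d * E t by rewrite mulr_gt0.
      have MqdE : 0 <= Mq * (d * E t) by rewrite mulr_ge0// ltW.
      rewrite /S in k1 q1 *.
      have -> : vt x t + (0 * (E t * p x) + - d * (K * E t * p x + E t * 0)) =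
        vt x t - K * (d * (E t * p x)) by ring.
      by lra.
  have := wle x0 t0 x0I; rewrite (ltW a't0) lexx => /(_ isT) h.
  have [|h1 _ _ _] := hv x0 t0 x0I; first by rewrite (ltW a't0) lexx.
  have {}h1 : u x0 t0 <= v x0 t0 + d.
    by move: h1; rewrite ler_norml => /andP[? ?]; lra.
  have /andP[_ p2] := pb x0 x0I.
  have EC : E t0 <= expR (K * (c - a)) by rewrite ler_expR ler_pM2l//; lra.
  have : d * (E t0 * p x0) <= d * (expR (K * (c - a)) * 3).
    rewrite ler_pM2l// ler_pM// ?(ltW (E0 _))//.
    by have /andP[+ _] := pb x0 x0I; lra.
  have -> : e = d * C by rewrite /d divfK// gt_eqF.
  have -> : d * C = d + d * (expR (K * (c - a)) * 3) by rewrite /C; ring.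
  by lra.
move=> x t xI /andP[]; rewrite le_eqVlt => /predU1P[<- _|at_]; first exact: ua.
rewrite le_eqVlt => /predU1P[tc|tc]; last by apply: main => //; rewrite at_.
(* at the final time itself, by continuity from earlier times *)
rewrite tc; apply/ler_addgt0Pr => e e0; rewrite add0r.
have [r r0 hr] := @heine R 0 1 a c (fun x t => u (clamp 0 1 x) (clamp a c t)) cu' _ e0.
pose m := Num.min r (c - a) / 2.
have m0 : 0 < Num.min r (c - a) by rewrite lt_min r0 subr_gt0.
have [m1 m2] : Num.min r (c - a) <= r /\ Num.min r (c - a) <= c - a.
  by rewrite !ge_min !lexx orbT.
have mE : m = Num.min r (c - a) / 2 by [].
have xI' : x \in `[0, 1] by rewrite in_itv.
have cI : c \in `[a, c] by rewrite in_itv /= lexx ltW.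
have cmI : c - m \in `[a, c] by rewrite in_itv /=; apply/andP; split; lra.
have := hr x (c - m) xI' cmI x c; rewrite subrr normr0 => /(_ r0).
have -> : c - (c - m) = m by ring.
rewrite gtr0_norm; last by lra.
rewrite !clamp_id// => h.
have : u x c - u x (c - m) < e by apply: le_lt_trans (ler_norm _) (h _); lra.
have : u x (c - m) <= 0 by apply: main => //; apply/andP; split; lra.
by lra.
Qed.

End comparison.

(** * Relaxation under strong damping *)
Section primitive.
Variable R : realType.

Lemma exists_primitive (f : R -> R) (a c : R) : a <= c ->
  (forall t, a <= t <= c -> {for t, continuous f}) ->
  exists F : R -> R, F a = 0 /\ forall t, a <= t <= c -> is_derive t 1 F (f t).
Proof.
move=> ac cf.
pose h (x t : R) := f (clamp a c t).
have ch : continuous (fun p : R * R => h p.1 p.2).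
  apply/continuous2P => x t e e0.
  have := clamp_itv t ac; rewrite in_itv /= => tI.
  have /cvgrPdist_lt/(_ _ e0)/nbhs_ballP[d /= d0 hd] := cf _ tI.
  exists d => // y s _ st; rewrite distrC; apply: hd; rewrite /ball /=.
  by rewrite distrC (le_lt_trans (clamp_contract _ _ _ _)).
(* started at a - 1, the primitive has a two-sided derivative at a *)
exists (fun t => time_primitive (a - 1) h 0 t - time_primitive (a - 1) h 0 a); split.
  by rewrite subrr.
move=> t /andP[at_ tc].
have -> : f t = h 0 t - 0 by rewrite /h subr0 clamp_id// in_itv /= at_ tc.
by apply: is_deriveB; apply: is_derive_time_primitive => //; lra.
Qed.

Lemma derive_continuous (f : R -> R) (x l : R) : is_derive x 1 f l ->
  {for x, continuous f}.
Proof.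
by move=> df; apply: differentiable_continuous; apply/derivable1_diffP; case: df.
Qed.

Lemma mean_value (f f' : R -> R) (s t : R) : s <= t ->
  (forall r, s <= r <= t -> is_derive r 1 f (f' r)) ->
  exists2 r, s <= r <= t & f t - f s = f' r * (t - s).
Proof.
move=> st df.
have dI r : r \in `[s, t] -> is_derive r 1 f (f' r) by rewrite in_itv; exact: df.
have [r rI E] := MVT_segment st (fun y yI => dI y (subset_itv_oo_cc yI))
  (derivable_within_continuous (fun y yI => let: DeriveDef d _ := dI y yI in d)).
by exists r => //; move: rI; rewrite in_itv.
Qed.

Lemma mean_value_oo (f f' : R -> R) (s t : R) : s < t ->
  (forall r, s <= r <= t -> is_derive r 1 f (f' r)) ->
  exists2 r, s < r < t & f t - f s = f' r * (t - s).
Proof.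
move=> st df.
have dI r : r \in `[s, t] -> is_derive r 1 f (f' r) by rewrite in_itv; exact: df.
have [r rI E] := MVT st (fun y yI => dI y (subset_itv_oo_cc yI))
  (derivable_within_continuous (fun y yI => let: DeriveDef d _ := dI y yI in d)).
by exists r => //; move: rI; rewrite in_itv.
Qed.

(** The rate beta may vanish at both ends of the interval, but its integral over
    intervals of length d is bounded below, by compactness. *)
Lemma primitive_gap (B beta : R -> R) (a c d : R) : 0 < d -> d < c - a ->
  (forall t, a <= t <= c -> is_derive t 1 B (beta t)) ->
  (forall t, a < t < c -> 0 < beta t) ->
  exists2 m, 0 < m & forall s t, a <= s -> s + d <= t -> t <= c -> m <= B t - B s.
Proof.
move=> d0 dL dB beta0.
have mono s t : a <= s -> s <= t -> t <= c -> B s <= B t.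
  move=> as_; rewrite le_eqVlt => /predU1P[->//|st] tc.
  have [|r /andP[sr rt] E] := mean_value_oo (f := B) (f' := beta) st.
    by move=> r /andP[? ?]; apply: dB; apply/andP; split; lra.
  rewrite -subr_ge0 E mulr_ge0 ?subr_ge0 ?(ltW st)// ltW// beta0//.
  by apply/andP; split; lra.
have acd : a <= c - d by lra.
have cB : {within `[a, c - d], continuous (fun s => B (s + d) - B s)}.
  apply: derivable_within_continuous => s; rewrite in_itv /= => /andP[? ?].
  have h1 : is_derive s 1 (fun s => B (s + d)) (beta (s + d)).
    by apply: is_derive_shiftr; apply: dB; apply/andP; split; lra.
  have h2 : is_derive s 1 B (beta s) by apply: dB; apply/andP; split; lra.
  by case: (is_deriveB h1 h2).
have [s0] := EVT_min acd cB; rewrite in_itv /= => /andP[as0 s0c] hs.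
exists (B (s0 + d) - B s0).
  have sd : s0 < s0 + d by rewrite ltrDl.
  have [|r /andP[? ?] ->] := mean_value_oo (f := B) (f' := beta) sd.
    by move=> r /andP[? ?]; apply: dB; apply/andP; split; lra.
  by rewrite mulr_gt0 ?beta0//; [apply/andP; split; lra|lra].
move=> s t as_ sdt tc.
apply: (@le_trans _ _ (B (s + d) - B s)).
  by apply: hs; rewrite in_itv /= as_; lra.
by rewrite lerD2r mono//; lra.
Qed.

Lemma is_derive_exp_comp (g : R -> R) (t l : R) : is_derive t 1 g l ->
  is_derive t 1 (fun s => expR (g s)) (expR (g t) * l).
Proof. by move=> dg; exact: (@is_derive1_comp _ expR g t). Qed.

Lemma mean_value_bound (F f : R -> R) (s t z : R) : s <= t ->
  (forall r, s <= r <= t -> is_derive r 1 F (f r)) ->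
  (forall r, s <= r <= t -> 0 <= f r <= z) -> 0 <= F t - F s <= z * (t - s).
Proof.
move=> st dF fz; have [r rI ->] := mean_value st dF.
have /andP[f0 fz'] := fz r rI.
by rewrite mulr_ge0 ?subr_ge0//= ler_wpM2r ?subr_ge0.
Qed.

(** F is the memory of a damped equation with integrating factor E: the last d
    units of time contribute at most d E t, everything before is damped by d. *)
Lemma memory_bound (E F : R -> R) (a c d t : R) : 0 < d -> F a = 0 ->
  (forall r, a <= r <= c -> is_derive r 1 F (E r)) ->
  (forall r, 0 < E r) ->
  (forall r s, a <= r -> r <= s -> s <= c -> E r <= E s) ->
  (forall r s, a <= r -> r + d <= s -> s <= c -> E r <= d * E s) ->
  a <= t <= c -> 0 <= F t <= d * (1 + (c - a)) * E t.
Proof.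
move=> d0 Fa dF E0 Emono Egap /andP[at_ tc].
have F_bd s r : a <= s -> s <= r -> r <= c -> 0 <= F r - F s <= E r * (r - s).
  move=> as_ sr rc; apply: (mean_value_bound sr) => w /andP[sw wr].
    by apply: dF; rewrite (le_trans as_ sw) (le_trans wr rc).
  by rewrite (ltW (E0 w)) Emono// (le_trans as_ sw).
have /andP[] := F_bd a t (lexx a) at_ tc; rewrite Fa subr0 => -> Ft /=.
have dE0 : 0 < d * E t by rewrite mulr_gt0.
have -> : d * (1 + (c - a)) * E t = d * E t + (c - a) * (d * E t) by ring.
have [tad|adt] := leP t (a + d).
  apply: (le_trans Ft); rewrite mulrC -[leLHS]addr0 lerD//.
    by rewrite ler_wpM2r ?(ltW (E0 t))// lerBlDl.
  by rewrite mulr_ge0 ?(ltW dE0)// subr_ge0 (le_trans at_).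
have atd : a <= t - d by rewrite lerBrDr ltW.
have tdt : t - d <= t by rewrite gerBl ltW.
have /andP[_ h1] := F_bd (t - d) t atd tdt tc.
have /andP[_] := F_bd a (t - d) (lexx a) atd (le_trans tdt tc).
rewrite Fa subr0 => h2.
rewrite -(subrK (F (t - d)) (F t)) lerD//.
  by rewrite (le_trans h1)// opprB addrC subrK mulrC.
rewrite (le_trans h2)// mulrC ler_pM ?subr_ge0 ?(ltW (E0 _))//.
  by rewrite lerD2r (le_trans tdt).
by apply: Egap => //; rewrite subrK.
Qed.

Lemma two_phase_bound (F f : R -> R) (a c d z1 z2 t : R) : 0 <= d -> 0 <= z2 ->
  a + d <= c -> F a = 0 ->
  (forall r, a <= r <= c -> is_derive r 1 F (f r)) ->
  (forall r, a <= r <= c -> 0 <= f r <= z1) ->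
  (forall r, a + d <= r <= c -> f r <= z2) ->
  a <= t <= c -> 0 <= F t <= z1 * d + z2 * (c - a).
Proof.
move=> d0 z20 adc Fa dF f1 f2 /andP[at_ tc].
have sub r : a <= r <= t -> a <= r <= c.
  by move=> /andP[-> rt]; rewrite (le_trans rt tc).
have /andP[] := mean_value_bound at_ (fun r rI => dF r (sub r rI))
  (fun r rI => f1 r (sub r rI)).
rewrite Fa subr0 => -> Ft /=.
have z10 : 0 <= z1.
  have /andP[f0 fz] : 0 <= f t <= z1 by apply: f1; rewrite at_.
  exact: le_trans f0 fz.
have ca0 : 0 <= c - a by rewrite subr_ge0 (le_trans at_).
have [tad|adt] := leP t (a + d).
  rewrite (le_trans Ft)// -[leLHS]addr0 lerD ?mulr_ge0//.
  by rewrite ler_wpM2l// lerBlDl.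
have aad : a <= a + d by rewrite lerDl.
have sub1 r : a <= r <= a + d -> a <= r <= c.
  by move=> /andP[-> ra]; rewrite (le_trans ra adc).
have sub2 r : a + d <= r <= t -> a <= r <= c.
  by move=> /andP[ar rt]; rewrite (le_trans aad ar) (le_trans rt tc).
have /andP[_] := mean_value_bound aad (fun r rI => dF r (sub1 r rI))
  (fun r rI => f1 r (sub1 r rI)).
rewrite Fa subr0 [a + d - a]addrC addKr => h1.
have f2' r : a + d <= r <= t -> 0 <= f r <= z2.
  move=> rI; have /andP[-> _] := f1 r (sub2 r rI).
  by case/andP: rI => ar rt; rewrite f2// ar (le_trans rt tc).
have /andP[_ h2] := mean_value_bound (ltW adt) (fun r rI => dF r (sub2 r rI)) f2'.
rewrite -(subrK (F (a + d)) (F t)) addrC lerD// (le_trans h2)// ler_wpM2l//.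
by rewrite lerB.
Qed.

(** theta = exp (- alpha B) (1 + M F) with B' = beta and F' = exp (alpha B).  After
    a time d both the initial value and the memory are below a multiple of d once
    alpha m > 1/d, where m is the gap of [primitive_gap].  D collects the constants
    so that all bounds follow from d D <= eta. *)
Lemma barrier_time (beta : R -> R) (a c M eta : R) : a < c -> 0 < M -> 0 < eta ->
  continuous beta -> (forall t, 0 <= beta t) ->
  (forall t, a < t < c -> 0 < beta t) ->
  exists A0, forall alpha, A0 < alpha -> exists theta Theta : R -> R,
    [/\ theta a = 1, Theta a = 0, theta c <= eta,
        forall t, a <= t <= c -> [/\ 0 <= theta t <= 1 + eta, 0 <= Theta t <= eta,
          is_derive t 1 Theta (theta t)
        & is_derive t 1 theta (M - alpha * beta t * theta t)]
      & 0 < alpha].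
Proof.
move=> ac M0 eta0 cb beta_ge0 beta0.
pose L := c - a.
have L0 : 0 < L by rewrite subr_gt0.
pose D := (1 + L) * (1 + M * (1 + L)).
have M1 : 0 < 1 + M * (1 + L) by rewrite addr_gt0// mulr_gt0// addr_gt0.
have D0 : 0 < D by rewrite mulr_gt0// addr_gt0.
pose d := Num.min (Num.min 1 (eta / D)) L / 2.
have m0 : 0 < Num.min (Num.min 1 (eta / D)) L by rewrite !lt_min ltr01 divr_gt0.
have [[m1 m2] m3] : (Num.min (Num.min 1 (eta / D)) L <= 1 /\
    Num.min (Num.min 1 (eta / D)) L <= eta / D) /\ Num.min (Num.min 1 (eta / D)) L <= L.
  by rewrite !ge_min !lexx !orbT.
have dE : d = Num.min (Num.min 1 (eta / D)) L / 2 by [].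
have [d0 d1 dL] : [/\ 0 < d, d <= 1 & d < c - a] by split; rewrite -/L; lra.
have dD : d * D <= eta by rewrite -ler_pdivlMr//; lra.
have [B [Ba dB]] := exists_primitive (ltW ac) (fun t _ => cb t).
have [m mm0 hm] := primitive_gap d0 dL dB beta0.
exists (1 / (d * m)) => alpha alphaA.
have alpha0 : 0 < alpha by rewrite (lt_trans _ alphaA)// divr_gt0// mulr_gt0.
have kappa : expR (- (alpha * m)) <= d.
  rewrite expRN -[leRHS]invrK lef_pV2 ?posrE ?invr_gt0 ?expR_gt0//.
  rewrite (le_trans _ (expR_ge1Dx _))// (@le_trans _ _ (alpha * m)) ?lerDr//.
  rewrite -ler_pdivrMr// ltW//; move: alphaA; rewrite div1r invfM.
  by [].
have mono s t : a <= s -> s <= t -> t <= c -> B s <= B t.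
  move=> as_ st tc; have [|r _ E] := mean_value (f := B) (f' := beta) st.
    by move=> r /andP[? ?]; apply: dB; apply/andP; split; lra.
  by rewrite -subr_ge0 E mulr_ge0// subr_ge0.
have dN t : a <= t <= c ->
    is_derive t 1 (fun s => expR (- alpha * (B s - 0)))
      (expR (- alpha * (B t - 0)) * (- alpha * beta t)).
  by move=> tI; apply: is_derive_exp_comp; apply: is_derive_affine; exact: dB.
pose k t := expR (- alpha * (B t - 0)).
pose E t := expR (alpha * (B t - 0)).
have kE t : k t * E t = 1.
  by rewrite /k /E -expRD mulNr addNr expR0.
have dE' t : a <= t <= c -> is_derive t 1 E (E t * (alpha * beta t)).
  by move=> tI; apply: is_derive_exp_comp; apply: is_derive_affine; exact: dB.
have k0 t : 0 < k t by exact: expR_gt0.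
have E0 t : 0 < E t by exact: expR_gt0.
have kgap s t : a <= s -> s + d <= t -> t <= c -> k t * E s <= d.
  move=> as_ sdt tc; rewrite (le_trans _ kappa)// /k /E -expRD ler_expR.
  have := hm s t as_ sdt tc => h.
  have -> : - alpha * (B t - 0) + alpha * (B s - 0) = - (alpha * (B t - B s)) by ring.
  by rewrite lerN2 ler_pM2l.
have Emono s t : a <= s -> s <= t -> t <= c -> E s <= E t.
  by move=> as_ st tc; rewrite ler_expR ler_pM2l// lerD2r mono.
have [F [Fa dF]] := exists_primitive (ltW ac) (fun t tI => derive_continuous (dE' t tI)).
have EgapD r s : a <= r -> r + d <= s -> s <= c -> E r <= d * E s.
  move=> ar rs sc; have := kgap r s ar rs sc.
  by rewrite -(ler_pM2r (E0 s)) mulrAC kE mul1r.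
pose rho := d * (1 + L).
have Mrho0 : 0 < M * rho by rewrite !mulr_gt0// addr_gt0.
have G_bd t : a <= t <= c -> 0 <= k t * F t <= rho.
  move=> tI; have /andP[F0 F1] := memory_bound d0 Fa dF E0 Emono EgapD tI.
  rewrite mulr_ge0 ?(ltW (k0 t))//= -(ler_pM2r (E0 t)) mulrAC kE mul1r.
  exact: F1.
pose theta t := k t * (1 + M * F t).
have thE t : theta t = k t + M * (k t * F t) by rewrite /theta; ring.
have dth t : a <= t <= c -> is_derive t 1 theta (M - alpha * beta t * theta t).
  move=> tI; have h1 : is_derive t 1 (fun s => 1 + M * F s) (0 + M * E t).
    by apply: is_deriveD; apply: is_deriveZ; exact: dF.
  have <- : k t * (- alpha * beta t) * (1 + M * F t) + k t * (0 + M * E t) =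
     M - alpha * beta t * theta t.
    transitivity ((k t * E t) * M - alpha * beta t * theta t).
      by rewrite /theta; ring.
    by rewrite kE mul1r.
  exact: (is_derive_mul (dN t tI) h1).
have theta_bd t z : a <= t <= c -> k t <= z -> 0 <= theta t <= z + M * rho.
  move=> tI kz; have /andP[h1 h2] := G_bd t tI; rewrite thE; apply/andP; split.
    by apply: addr_ge0; [exact: ltW|exact: mulr_ge0 (ltW M0) h1].
  by apply: lerD; [exact: kz|rewrite ler_pM2l].
have th1 t : a <= t <= c -> 0 <= theta t <= 1 + M * rho.
  move=> tI; apply: theta_bd => //; case/andP: tI => at_ tc.
  rewrite -expR0 ler_expR mulNr oppr_le0 mulr_ge0 ?(ltW alpha0)//.
  by rewrite subr0 -Ba mono.
have th2 t : a + d <= t <= c -> theta t <= d + M * rho.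
  move=> /andP[adt tc]; have at_ : a <= t by rewrite (le_trans _ adt)// lerDl ltW.
  have kd : k t <= d.
    by have := kgap a t (lexx a) adt tc; rewrite /E Ba subrr mulr0 expR0 mulr1.
  by have /andP[] : 0 <= theta t <= d + M * rho by apply: theta_bd; rewrite ?at_.
have [Th [Tha dTh]] := exists_primitive (ltW ac) (fun t tI => derive_continuous (dth t tI)).
(* the left-hand side is d D *)
have dMr : d * L + (1 + L) * (M * rho) + d <= eta.
  rewrite (le_trans _ dD)// /D /rho.
  have -> : d * ((1 + L) * (1 + M * (1 + L))) =
    d * L + (1 + L) * (M * (d * (1 + L))) + d by ring.
  exact: lexx.
have Mr_eta : M * rho <= eta.
  rewrite (le_trans _ dMr)// -subr_ge0.
  have -> : d * L + (1 + L) * (M * rho) + d - M * rho =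
    d * L + L * (M * rho) + d by ring.
  by apply: addr_ge0 (ltW d0); apply: addr_ge0; apply: mulr_ge0; exact: ltW.
have adc : a + d <= c by rewrite -lerBrDl ltW.
have tot : (1 + M * rho) * d + (d + M * rho) * L <= eta.
  rewrite (le_trans _ dMr)// -subr_ge0.
  have -> : d * L + (1 + L) * (M * rho) + d - ((1 + M * rho) * d + (d + M * rho) * L) =
    M * rho * (1 - d) by ring.
  by rewrite mulr_ge0 ?(ltW Mrho0)// subr_ge0.
exists theta, Th; split => //.
- by rewrite /theta /k Fa Ba subrr mulr0 expR0 mulr0 addr0 mulr1.
- rewrite (le_trans (th2 c _)) ?lexx ?adc// (le_trans _ dMr)// -subr_ge0.
  have -> : d * L + (1 + L) * (M * rho) + d - (d + M * rho) =
    d * L + L * (M * rho) by ring.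
  by apply: addr_ge0; apply: mulr_ge0; exact: ltW.
- move=> t tI; have /andP[h1 h2] := th1 t tI.
  split; [|..|exact: dTh|exact: dth].
    by rewrite h1 (le_trans h2)// lerD2l.
  have drho0 : 0 <= d + M * rho by apply: addr_ge0; exact: ltW.
  have /andP[-> h3] := two_phase_bound (ltW d0) drho0 adc Tha dTh th1 th2 tI.
  exact: le_trans h3 tot.
Qed.

End primitive.

(** * Barriers for strong drift *)
Section transport.
Variable R : realType.
Implicit Types (a c e lam t x y : R) (b f P : R -> R) (u V : R -> R -> R).

(** The drift points away from e, so that e is where the transported values come
    from.  The sign condition unites b < 0 with e = 0 and b > 0 with e = 1; it uses
    |x - e| <= 1. *)
Definition inflow a c e b := [/\ forall t, a < t < c -> b t != 0
  & forall x t, 0 <= x <= 1 -> a < t < c ->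
      `|b t| * (x - e) ^+ 2 <= - b t * (x - e)].

Lemma is_derive_sq_dist e x :
  is_derive x 1 (fun x => (x - e) ^+ 2) (2 * (x - e)).
Proof.
have h1 : is_derive x 1 (fun x => x - e) (1 - 0) by apply: is_deriveB.
have -> : 2 * (x - e) = (1 - 0) * (x - e) + (x - e) * (1 - 0) by ring.
exact: (is_derive_mul h1 h1).
Qed.

(** q = exp e1 + K (theta (x-e)^2 + 2 Theta) satisfies
      q_t - q_xx - alpha b q_x = K (M - alpha |b| theta) (x-e)^2
                                  - 2 K alpha theta b (x-e) >= K M (x-e)^2
    by the sign condition in [inflow], and q <= exp e1 + 4 K once eta <= 1, which
    dictates M. *)
Lemma transport_barrier a c e (e1 K K' : R) b : a < c -> 0 <= e <= 1 -> 0 < e1 ->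
  0 < K -> 0 < K' -> continuous b -> inflow a c e b ->
  exists A0, forall alpha, A0 < alpha -> 0 < alpha /\
  exists q qx qxx qt : R -> R -> R, classical_on a c q qx qxx qt /\
  [/\ forall x, q x a = expR e1 + K * (x - e) ^+ 2,
      forall x, 0 <= x <= 1 -> q x c <= expR (2 * e1),
      forall x t, 0 <= x <= 1 -> a <= t <= c -> expR e1 <= q x t,
      forall t, a < t < c -> qx 0 t <= 0 <= qx 1 t
    & forall x t, 0 < x < 1 -> a < t < c ->
        K' * (x - e) ^+ 2 * q x t <= qt x t - qxx x t - alpha * b t * qx x t].
Proof.
move=> ac /andP[e0 e1'] e10 K0 K'0 cb [b0 bs].
(* at the final time q exceeds exp e1 by at most 3 K eta *)
pose eta := Num.min 1 ((expR (2 * e1) - expR e1) / (3 * K)).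
have K30 : 0 < 3 * K by rewrite mulr_gt0.
have ee : expR e1 < expR (2 * e1) by rewrite ltr_expR; lra.
have eta0 : 0 < eta by rewrite lt_min ltr01 divr_gt0// subr_gt0.
have [eta1 eta2] : eta <= 1 /\ eta <= (expR (2 * e1) - expR e1) / (3 * K).
  by rewrite /eta !ge_min !lexx orbT.
rewrite ler_pdivlMr// in eta2.
pose M := K' * (expR e1 + 4 * K) / K.
have M0 : 0 < M by rewrite divr_gt0// mulr_gt0// addr_gt0 ?expR_gt0// mulr_gt0.
have cnb : continuous (fun t => `|b t|).
  by move=> t; apply: (@cvg_norm R R^o); exact: cb.
have [t tI|A0 hA] := barrier_time ac M0 eta0 cnb (fun t => normr_ge0 _).
  by rewrite normr_gt0 b0.
exists A0 => alpha /hA[th [Th [tha Tha thc bd alpha0]]]; split => //.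
exists (fun x t => expR e1 + K * (th t * (x - e) ^+ 2 + 2 * Th t)),
  (fun x t => K * (th t * (2 * (x - e)))), (fun x t => K * (th t * 2)),
  (fun x t => K * ((M - alpha * `|b t| * th t) * (x - e) ^+ 2 + 2 * th t)).
have sq x : 0 <= x <= 1 -> 0 <= (x - e) ^+ 2 <= 1.
  move=> /andP[x0 x1]; rewrite sqr_ge0 /= -subr_ge0.
  have -> : 1 - (x - e) ^+ 2 = (1 - (x - e)) * (1 + (x - e)) by ring.
  by rewrite mulr_ge0//; lra.
split.
  have dp' x : is_derive x 1 (fun x => 2 * (x - e)) 2.
    by rewrite -[X in is_derive _ _ _ X]mulr1; apply: is_derive_affine; exact: is_derive_id.
  have cl1 := classical_on_space a c (fun x => is_derive_sq_dist e x) dp'.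
  have dth t : a <= t <= c -> is_derive t 1 (fun t => K * th t)
      (K * (M - alpha * `|b t| * th t)).
    by move=> /bd[_ _ _ d]; apply: is_deriveZ.
  have cl2 := classical_on_scale dth cl1.
  have cl3 := classical_on_space a c (fun x => is_derive_cst (1 : R) x 1)
    (fun x => is_derive_cst (0 : R) x 1).
  have dTh t : a <= t <= c -> is_derive t 1 (fun t => expR e1 + (2 * K) * Th t)
      (0 + (2 * K) * th t).
    by move=> /bd[_ _ d _]; apply: is_deriveD; apply: is_deriveZ.
  have cl4 := classical_on_scale dTh cl3.
  have := classical_onD cl2 cl4.
  congr classical_on; apply/funext => x; apply/funext => t /=; ring.
split.
- by move=> x; rewrite tha Tha; ring.
- move=> x xI; have /andP[s0 s1] := sq x xI.
  have [|/andP[h1 _] /andP[h2 h3] _ _] := bd c; first by rewrite lexx ltW.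
  have h5 : th c * (x - e) ^+ 2 <= th c by rewrite ler_piMr.
  have h4 : th c * (x - e) ^+ 2 + 2 * Th c <= 3 * eta by lra.
  have : K * (th c * (x - e) ^+ 2 + 2 * Th c) <= K * (3 * eta) by rewrite ler_pM2l.
  by lra.
- move=> x t xI tI; have /andP[s0 s1] := sq x xI.
  have [/andP[h1 _] /andP[h2 _] _ _] := bd t tI.
  rewrite lerDl; apply: mulr_ge0; first exact: ltW.
  by apply: addr_ge0; apply: mulr_ge0.
- move=> t /andP[at_ tc]; have [|/andP[h1 _] _ _ _] := bd t; first by rewrite !ltW.
  rewrite sub0r; apply/andP; split.
    rewrite !mulrN oppr_le0; apply: mulr_ge0; first exact: ltW.
    by apply: mulr_ge0 => //; apply: mulr_ge0.
  apply: mulr_ge0; first exact: ltW.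
  by apply: mulr_ge0 => //; apply: mulr_ge0 => //; rewrite subr_ge0.
- move=> x t /andP[x0 x1] tI.
  have xI : 0 <= x <= 1 by rewrite !ltW.
  have tI' : a <= t <= c by case/andP: tI => ? ?; rewrite !ltW.
  have /andP[s0 s1] := sq x xI.
  have [/andP[h1 h1'] /andP[h2 h2'] _ _] := bd t tI'.
  have hbs := bs x t xI tI.
  set s := (x - e) ^+ 2 in s0 s1 hbs *.
  have q4 : expR e1 + K * (th t * s + 2 * Th t) <= expR e1 + 4 * K.
    have : th t * s <= th t by rewrite ler_piMr.
    have h : th t * s <= th t -> th t * s + 2 * Th t <= 4 by lra.
    by move=> /h; rewrite -(ler_pM2l K0); lra.
  apply: (@le_trans _ _ (K' * s * (expR e1 + 4 * K))).
    by rewrite ler_wpM2l// mulr_ge0// ltW.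
  have -> : K' * s * (expR e1 + 4 * K) = K * (M * s).
    by rewrite /M; field; rewrite gt_eqF.
  have -> : K * ((M - alpha * `|b t| * th t) * s + 2 * th t) - K * (th t * 2) -
      alpha * b t * (K * (th t * (2 * (x - e)))) =
    K * (M * s) + (K * alpha * th t) * (2 * (- b t * (x - e)) - `|b t| * s) by ring.
  rewrite lerDl; apply: mulr_ge0.
    by apply: mulr_ge0 => //; apply: mulr_ge0; exact: ltW.
  have : 0 <= `|b t| * s by rewrite mulr_ge0.
  by lra.
Qed.

End transport.

Section transport_stages.
Variable R : realType.
Implicit Types (a c e lam k x t y : R) (b f P : R -> R) (u V h : R -> R -> R).

(** Uniform continuity near x = e, and a large K away from it. *)
Lemma quadratic_modulus a c e (d : R) h : a <= c -> 0 <= e <= 1 -> 0 < d ->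
  {within `[0, 1] `*` `[a, c], continuous (fun p : R * R => h p.1 p.2)} ->
  exists2 K : R, 0 < K & forall x t, 0 <= x <= 1 -> a <= t <= c ->
    `|h x t - h e t| <= d + K * (x - e) ^+ 2.
Proof.
move=> ac eI d0 ch.
have [M M0 hM] := bounded_box (@ler01 R) ac ch.
have ch' := continuous_clamp ac ch.
have [r r0 hr] := @heine R 0 1 a c (fun x t => h (clamp 0 1 x) (clamp a c t)) ch' _ d0.
exists (2 * M / r ^+ 2); first by rewrite divr_gt0 ?exprn_gt0// mulr_gt0.
move=> x t xI tI.
have K0 : 0 < 2 * M / r ^+ 2 by rewrite divr_gt0 ?exprn_gt0// mulr_gt0.
have eI' : e \in `[0, 1] by rewrite in_itv.
have xI' : x \in `[0, 1] by rewrite in_itv.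
have tI' : t \in `[a, c] by rewrite in_itv.
have [xr|rx] := ltP `|x - e| r.
  have := hr e t eI' tI' x t xr; rewrite subrr normr0 => /(_ r0).
  rewrite !clamp_id// => /ltW h1; rewrite (le_trans h1)// lerDl mulr_ge0 ?sqr_ge0//.
  exact: ltW.
have h1 : `|h x t - h e t| <= 2 * M.
  rewrite (le_trans (ler_normB _ _))//.
  by have := hM x t xI' tI'; have := hM e t eI' tI'; lra.
have h2 : r ^+ 2 <= (x - e) ^+ 2.
  rewrite -(real_normK (num_real (x - e))) lerXn2r// nnegrE ?(ltW r0)//.
have h3 : 2 * M <= 2 * M / r ^+ 2 * (x - e) ^+ 2.
  rewrite mulrAC ler_pdivlMr ?exprn_gt0// ler_pM2l//.
  by rewrite mulr_gt0.
by lra.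
Qed.

Lemma within_const_time a c f : {within `[0, 1], continuous f} ->
  {within `[0, 1] `*` `[a, c], continuous (fun p : R * R => f p.1)}.
Proof.
move=> /subspace_continuousP cf.
apply: (within_continuous2P _ (fun x _ => f x)).2 => x t [/= xI _] d d0.
have /cvgrPdist_lt/(_ _ d0) := cf x xI.
rewrite near_withinE => /nbhs_ballP[r /= r0 hr]; exists r => // y s [/= yI _] yx _.
by rewrite distrC; apply: hr => //; rewrite /ball /= distrC.
Qed.

(** Initial data are compared with the barriers in both directions, hence the
    symmetric form in f x and f e. *)
Lemma quadratic_ratio e (d : R) f : 0 <= e <= 1 -> 0 < d ->
  {within `[0, 1], continuous f} -> (forall x, 0 <= x <= 1 -> 0 < f x) ->
  exists2 K : R, 0 < K & forall x, 0 <= x <= 1 ->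
    f x <= f e * (expR d + K * (x - e) ^+ 2) /\
    f e <= f x * (expR d + K * (x - e) ^+ 2).
Proof.
move=> eI d0 cf f0.
have [x0] := EVT_min (@ler01 R) cf; rewrite in_itv /= => x0I hmin.
have m0 := f0 _ x0I.
have ed : 0 < expR d - 1 by rewrite subr_gt0 -expR0 ltr_expR.
have d'0 : 0 < f x0 * (expR d - 1) by rewrite mulr_gt0.
have [K K0 hK] := @quadratic_modulus 0 0 e _ (fun x _ => f x) (lexx 0) eI d'0
  (@within_const_time 0 0 f cf).
exists (K / f x0); first by rewrite divr_gt0.
move=> x xI; have := hK x 0 xI; rewrite lexx => /(_ isT).
set s := (x - e) ^+ 2; have s0 : 0 <= s by rewrite sqr_ge0.
have key y : 0 <= y <= 1 -> f x0 * (expR d - 1) + K * s <=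
    f y * (expR d + K / f x0 * s) - f y.
  move=> yI; have h1 : f x0 <= f y by apply: hmin; rewrite in_itv.
  have -> : f y * (expR d + K / f x0 * s) - f y =
    f y * (expR d - 1) + f y * (K / f x0 * s) by ring.
  rewrite lerD//; first by rewrite ler_pM2r.
  have -> : K * s = f x0 * (K / f x0 * s) by field; rewrite gt_eqF.
  by rewrite ler_wpM2r// mulr_ge0// ltW// divr_gt0.
have := key e eI; have := key x xI.
by rewrite ler_norml => ? ? /andP[? ?]; split; lra.
Qed.

Lemma bounded_time a c b : a <= c -> continuous b ->
  exists2 M : R, 0 < M & forall t, a <= t <= c -> `|b t| <= M.
Proof.
move=> ac cb.
have cb2 : {within `[0, 1] `*` `[a, c], continuous (fun p : R * R => b p.2)}.
  apply: continuous_subspaceT => p; apply: (@continuous_comp _ _ _ snd b).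
    exact: cvg_snd.
  exact: cb.
have [M M0 hM] := @bounded_box R 0 1 a c (fun _ t => b t) (@ler01 R) ac cb2.
exists M => // t tI; apply: (hM 0 t); last by rewrite in_itv.
by rewrite in_itv /= lexx ler01.
Qed.

Lemma bounded_potential a c V lam : a <= c ->
  {within `[0, 1] `*` [set: R], continuous (fun p : R * R => V p.1 p.2)} ->
  exists2 M : R, 0 < M & forall x t, 0 <= x <= 1 -> a <= t <= c ->
    `|V x t - lam| <= M.
Proof.
move=> ac cV.
have cV' : {within `[0, 1] `*` `[a, c], continuous (fun p : R * R => V p.1 p.2 - lam)}.
  have cV2 : {within `[0, 1] `*` `[a, c], continuous (fun p : R * R => V p.1 p.2)}.
    by apply: continuous_subspaceW cV => p [].
  by move=> p; apply: (@cvgB R R^o); [exact: cV2|exact: cvg_cst].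
have [M M0 hM] := @bounded_box R 0 1 a c (fun x t => V x t - lam) (@ler01 R) ac cV'.
by exists M => // x t xI tI; apply: hM; rewrite in_itv.
Qed.

(** For the reciprocal barrier the term 2 q_x^2 / q^3 coming from its second
    derivative has the favourable sign, so q serves for both directions. *)
Lemma transport_stage a c e (eps : R) b V f P : a < c -> 0 <= e <= 1 -> 0 < eps ->
  continuous b -> inflow a c e b ->
  {within `[0, 1] `*` [set: R], continuous (fun p : R * R => V p.1 p.2)} ->
  {within `[0, 1], continuous f} -> (forall x, 0 <= x <= 1 -> 0 < f x) ->
  P a = 0 -> (forall t, a <= t <= c -> is_derive t 1 P (V e t)) ->
  exists A0, forall alpha, A0 < alpha -> forall lam u k, 0 < k ->
    {within `[0, 1] `*` `[a, c], continuous (fun p : R * R => u p.1 p.2)} ->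
    approx_solution a c (fun t => alpha * b t) (fun x t => V x t - lam) u ->
    ((forall x, 0 <= x <= 1 -> u x a <= k * f x) ->
     forall x, 0 <= x <= 1 ->
       u x c <= k * (f e * expR (lam * (c - a) - P c)) * expR eps) /\
    ((forall x, 0 <= x <= 1 -> k * f x <= u x a) ->
     forall x, 0 <= x <= 1 ->
       k * (f e * expR (lam * (c - a) - P c)) * expR (- eps) <= u x c).
Proof.
move=> ac eI eps0 cb ib cV cf f0 Pa dP.
have L2 : 0 < c - a + 2 by lra.
(* d (c - a) from Gamma and 2 d from the final value of q add up to eps *)
pose d := eps / (c - a + 2).
have d0 : 0 < d by rewrite divr_gt0.
have dE : d * (c - a) + 2 * d = eps by rewrite /d; field; rewrite gt_eqF.
have [K K0 hK] := quadratic_ratio eI d0 cf f0.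
have cV2 : {within `[0, 1] `*` `[a, c], continuous (fun p : R * R => V p.1 p.2)}.
  by apply: continuous_subspaceW cV => p [].
have [K' K'0 hK'] := quadratic_modulus (ltW ac) eI d0 cV2.
have [A0 hA] := transport_barrier ac eI d0 K0 K'0 cb ib.
exists A0 => alpha /hA[alpha0 [q [qx [qxx [qt [clq [qa qc qge qbd qpde]]]]]]].
move=> lam u k k0 cu hu.
have [Mb Mb0 hb] := bounded_time (ltW ac) cb.
have [Mq Mq0 hq] := bounded_potential lam (ltW ac) cV.
have hb' t : a <= t <= c -> `|alpha * b t| <= alpha * Mb.
  by move=> tI; rewrite normrM gtr0_norm// ler_pM2l// hb.
have cmp w : {within `[0, 1] `*` `[a, c], continuous (fun p : R * R => w p.1 p.2)} ->
    approx_subsolution a c (fun t => alpha * b t) (fun x t => V x t - lam) w ->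
    (forall x, 0 <= x <= 1 -> w x a <= 0) ->
    forall x t, 0 <= x <= 1 -> a <= t <= c -> w x t <= 0.
  by apply: comparison hb' hq; rewrite ?mulr_ge0 ?ltW.
have [hu1 hu2] := approx_solution_sub hu.
have kf0 : 0 < k * f e by rewrite mulr_gt0// f0.
pose G (m t : R) := expR (m * (t - a) - P t).
have dG (m t : R) : a <= t <= c -> is_derive t 1 (G m) (G m t * (m - V e t)).
  move=> tI; apply: is_derive_exp_comp; apply: is_deriveB; last exact: dP.
  by rewrite -[X in is_derive _ _ _ X]mulr1; apply: is_derive_affine; exact: is_derive_id.
have G0 m t : 0 < G m t by exact: expR_gt0.
have Ga m : G m a = 1 by rewrite /G Pa subrr mulr0 subr0 expR0.
have cI : a <= c <= c by rewrite lexx ltW.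
have aI : a <= a <= c by rewrite lexx ltW.
have q0 x t : 0 <= x <= 1 -> a <= t <= c -> 0 < q x t.
  by move=> xI tI; rewrite (lt_le_trans _ (qge x t xI tI))// expR_gt0.
have sqG (m j : R) : m = lam + j -> G m c = expR (lam * (c - a) - P c) * expR (j * (c - a)).
  by move=> ->; rewrite /G -expRD; congr expR; ring.
split=> hini x xI.
- have dg t : a <= t <= c -> is_derive t 1 (fun t => - (k * f e) * G (lam + d) t)
      (- (k * f e) * (G (lam + d) t * (lam + d - V e t))).
    by move=> tI; apply: is_deriveZ; exact: dG.
  have clW := classical_on_scale dg clq.
  have subW : approx_subsolution a c (fun t => alpha * b t) (fun x t => V x t - lam)
      (fun x t => - (k * f e) * G (lam + d) t * q x t).
    apply: classical_subsolution clW _ => y t yI tI.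
    have tI' : a <= t <= c by case/andP: tI => ? ?; rewrite !ltW.
    have g0 : 0 < (k * f e) * G (lam + d) t by rewrite mulr_gt0.
    have /andP[qx0 qx1] := qbd t tI.
    split.
    + by rewrite !mulNr oppr_ge0 mulr_ge0_le0// ltW.
    + by rewrite !mulNr oppr_le0 mulr_ge0// ltW.
    + move=> y01; have hX := qpde y t y01 tI; have hV := hK' y t yI tI'.
      rewrite -[leLHS]opprK oppr_le0.
      set W := (X in 0 <= X).
      have -> : W = k * f e * G (lam + d) t * ((V y t - V e t + d) * q y t +
        (qt y t - qxx y t - alpha * b t * qx y t)) by rewrite /W; ring.
      rewrite mulr_ge0 ?(ltW g0)//.
      have h1 : 0 <= (V y t - V e t + d + K' * (y - e) ^+ 2) * q y t.
        rewrite mulr_ge0 ?(ltW (q0 _ _ _ _))//.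
        by move: hV; rewrite ler_norml => /andP[? ?]; lra.
      by rewrite mulrDl in h1; lra.
  have := cmp _ _ (approx_subsolutionD hu1 subW).
  have cW : {within `[0, 1] `*` `[a, c], continuous (fun p : R * R =>
      u p.1 p.2 + - (k * f e) * G (lam + d) p.2 * q p.1 p.2)}.
    by case: clW => cw _ _ p; apply: (@cvgD R R^o); [exact: cu|exact: cw].
  move=> /(_ cW) H; have {}H := H _ x c xI cI.
  have H2 : u x c + - (k * f e) * G (lam + d) c * q x c <= 0.
    apply: H => y yI; rewrite Ga qa mulr1.
    have [h1 _] := hK y yI.
    have : k * f y <= k * (f e * (expR d + K * (y - e) ^+ 2)) by rewrite ler_pM2l.
    by have := hini y yI; lra.
  have h3 : (k * f e * G (lam + d) c) * q x c <= (k * f e * G (lam + d) c) * expR (2 * d).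
    by rewrite ler_pM2l ?qc// mulr_gt0.
  have h4 : k * f e * G (lam + d) c * expR (2 * d) =
      k * (f e * expR (lam * (c - a) - P c)) * expR eps.
    have -> : expR eps = expR (d * (c - a)) * expR (2 * d) by rewrite -expRD dE.
    by rewrite (sqG _ d)//; ring.
  by lra.
- have dg t : a <= t <= c -> is_derive t 1 (fun t => (k * f e) * G (lam - d) t)
      ((k * f e) * (G (lam - d) t * (lam - d - V e t))).
    by move=> tI; apply: is_deriveZ; exact: dG.
  have clW := classical_on_scale dg (classical_on_inv q0 clq).
  have subW : approx_subsolution a c (fun t => alpha * b t) (fun x t => V x t - lam)
      (fun x t => (k * f e) * G (lam - d) t * (q x t)^-1).
    apply: classical_subsolution clW _ => y t yI tI.
    have tI' : a <= t <= c by case/andP: tI => ? ?; rewrite !ltW.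
    have g0 : 0 < (k * f e) * G (lam - d) t by rewrite mulr_gt0.
    have /andP[qx0 qx1] := qbd t tI.
    split.
    + by rewrite mulr_ge0 ?(ltW g0)// mulr_ge0 ?oppr_ge0 ?sqr_ge0.
    + by rewrite mulr_ge0_le0 ?(ltW g0)// mulr_le0_ge0 ?oppr_le0 ?sqr_ge0.
    + move=> y01; have hX := qpde y t y01 tI; have hV := hK' y t yI tI'.
      set r := (q y t)^-1.
      have r0 : 0 < r by rewrite invr_gt0 q0.
      have rq : r * q y t = 1 by rewrite mulVf// gt_eqF// q0.
      set W := (X in X <= 0).
      have -> : W = k * f e * G (lam - d) t * ((V y t - V e t - d) * r -
        (qt y t - qxx y t - alpha * b t * qx y t) * r ^+ 2 -
        2 * qx y t ^+ 2 * r ^+ 3) by rewrite /W /r; ring.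
      rewrite mulr_ge0_le0 ?(ltW g0)//.
      have h1 : (V y t - V e t - d) * r <= K' * (y - e) ^+ 2 * r.
        rewrite ler_pM2r//.
        by move: hV; rewrite ler_norml => /andP[? ?]; lra.
      have h2 : K' * (y - e) ^+ 2 * q y t * r ^+ 2 <=
          (qt y t - qxx y t - alpha * b t * qx y t) * r ^+ 2.
        by rewrite ler_wpM2r// sqr_ge0.
      have h3 : 0 <= 2 * qx y t ^+ 2 * r ^+ 3.
        by apply: mulr_ge0; [rewrite mulr_ge0// sqr_ge0|rewrite exprn_ge0// ltW].
      have h4 : K' * (y - e) ^+ 2 * q y t * r ^+ 2 = K' * (y - e) ^+ 2 * r * (r * q y t).
        by ring.
      by rewrite rq mulr1 in h4; lra.
  have := cmp _ _ (approx_subsolutionD subW hu2).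
  have cW : {within `[0, 1] `*` `[a, c], continuous (fun p : R * R =>
      (k * f e) * G (lam - d) p.2 * (q p.1 p.2)^-1 + - u p.1 p.2)}.
    by case: clW => cw _ _ p; apply: (@cvgB R R^o); [exact: cw|exact: cu].
  move=> /(_ cW) H; have {}H := H _ x c xI cI.
  have H2 : (k * f e) * G (lam - d) c * (q x c)^-1 + - u x c <= 0.
    apply: H => y yI; rewrite Ga qa mulr1.
    have [_ h1] := hK y yI.
    have qy0 : 0 < expR d + K * (y - e) ^+ 2 by rewrite -qa q0.
    have : (k * f e) * (expR d + K * (y - e) ^+ 2)^-1 <= k * f y.
      by rewrite ler_pdivrMr// -mulrA ler_pM2l.
    by have := hini y yI; lra.
  have h3 : (k * f e * G (lam - d) c) * expR (- (2 * d)) <=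
      (k * f e * G (lam - d) c) * (q x c)^-1.
    have g0 : 0 < k * f e * G (lam - d) c by rewrite mulr_gt0.
    rewrite (ler_pM2l g0) expRN lef_pV2 ?posrE ?expR_gt0 ?q0//.
    exact: qc.
  have h4 : k * f e * G (lam - d) c * expR (- (2 * d)) =
      k * (f e * expR (lam * (c - a) - P c)) * expR (- eps).
    have -> : expR (- eps) = expR (- d * (c - a)) * expR (- (2 * d)).
      by rewrite -expRD -dE; congr expR; ring.
    by rewrite (sqG _ (- d))//; ring.
  by lra.
Qed.

End transport_stages.

(** * The limit solution on a transport stage *)
Section limit_solutions.
Variable R : realType.
Implicit Types (a c e lam k x t y : R) (b f g P beta : R -> R) (u q V h psi phi : R -> R -> R).

Lemma endpoint_eq f g x : x \in `[0, 1] ->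
  {for x, continuous (fun y => f (clamp 0 1 y))} ->
  {for x, continuous (fun y => g (clamp 0 1 y))} ->
  (forall y, 0 < y < 1 -> f y = g y) -> f x = g x.
Proof.
move=> xI /cvgrPdist_lt cf /cvgrPdist_lt cg fg.
apply/eqP; rewrite -subr_eq0 -normr_le0; apply/ler_addgt0Pr => e e0; rewrite add0r.
have e2 : 0 < e / 2 by rewrite divr_gt0.
have /nbhs_ballP[d1 /= d10 h1] := cf _ e2.
have /nbhs_ballP[d2 /= d20 h2] := cg _ e2.
have [y [yI yd1 yd2]] : exists y, [/\ 0 < y < 1, `|x - y| < d1 & `|x - y| < d2].
  pose m := Num.min (Num.min d1 d2) 1 / 2.
  have m0 : 0 < Num.min (Num.min d1 d2) 1 by rewrite !lt_min d10 d20 ltr01.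
  have [[m1 m2] m3] : (Num.min (Num.min d1 d2) 1 <= d1 /\
    Num.min (Num.min d1 d2) 1 <= d2) /\ Num.min (Num.min d1 d2) 1 <= 1.
    by rewrite !ge_min !lexx !orbT.
  have mE : m = Num.min (Num.min d1 d2) 1 / 2 by [].
  move: xI; rewrite in_itv /= => /andP[x0 x1].
  have [xh|xh] := leP x (1 / 4).
    exists (x + m); have -> : x - (x + m) = - m by ring.
    by rewrite normrN gtr0_norm; [split; [apply/andP; split| |]|]; lra.
  exists (x - m / 4); have -> : x - (x - m / 4) = m / 4 by ring.
  by rewrite gtr0_norm; [split; [apply/andP; split| |]|]; lra.
have yI' : y \in `[0, 1] by case/andP: yI => ? ?; rewrite in_itv /= !ltW.
have := h1 y yd1; have := h2 y yd2; rewrite !clamp_id// (fg y yI) => H2 H1.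
have -> : f x - g x = (f x - g y) - (g x - g y) by ring.
by rewrite (le_trans (ler_normB _ _))// [leRHS]splitr lerD// ltW.
Qed.

Lemma continuous_clamp1 f : {within `[0, 1], continuous f} ->
  continuous (fun y => f (clamp 0 1 y)).
Proof.
move=> cf; have cf2 := @within_const_time R 0 0 f cf.
have := @continuous_clamp R 0 0 (fun x _ => f x) (lexx 0) cf2.
exact: (@continuous2_l R (fun x _ => f (clamp 0 1 x)) 0).
Qed.

(** At time 0 the limit solution is only known to be periodic for 0 < x < 1; its
    Neumann condition makes it continuous up to the ends. *)
Lemma continuous_of_derive_within f x l : x \in `[0, 1] ->
  is_derive_within `[0, 1] f x l -> {for x, continuous (fun y => f (clamp 0 1 y))}.
Proof.
move=> xI /is_derive_withinP H; apply/cvgrPdist_le => e e0.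
have [d d0 hd] := H 1 ltr01.
have l0 : 0 < 1 + `|l| by rewrite ltr_wpDr.
apply/nbhs_ballP; exists (Num.min d (e / (1 + `|l|))).
  by rewrite /= lt_min d0 divr_gt0.
move=> y; rewrite /ball /= lt_min => /andP[yd ye].
rewrite (clamp_id xI); set z := clamp 0 1 y.
have zI : `[0, 1]%classic z by exact: clamp_itv.
have zx : `|z - x| <= `|x - y|.
  by rewrite distrC -{1}(clamp_id xI); exact: clamp_contract.
have [->|zNx] := eqVneq z x; first by rewrite subrr normr0 ltW.
have h0 : z - x != 0 by rewrite subr_eq0.
have := hd z zI zNx (le_lt_trans zx yd) => h1.
rewrite distrC -(divfK h0 (f z - f x)) normrM.
apply: (@le_trans _ _ ((1 + `|l|) * (e / (1 + `|l|)))); last first.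
  by rewrite mulrCA divff ?mulr1// gt_eqF.
apply: ler_pM => //; last by rewrite (le_trans zx)// ltW.
rewrite -(subrK l ((f z - f x) / (z - x))) (le_trans (ler_normD _ _))//.
by rewrite lerD2r.
Qed.

Lemma within_eq f g : {within `[0, 1], continuous f} ->
  (forall x, 0 <= x <= 1 -> f x = g x) -> {within `[0, 1], continuous g}.
Proof.
move=> cf fg; apply: (subspace_eq_continuous _ cf) => x /set_mem /=.
by rewrite in_itv /=; exact: fg.
Qed.

(** psi exp (P - lam (t - a)) has zero t-derivative, hence is constant in t; its
    limit at the beginning of the stage is psi e (ti i) for every 0 < x < 1. *)
Lemma ode_piece_value (ti : nat -> R) V lam psi i e P : ti i < ti i.+1 ->
  ode_piece ti V lam psi i e ->
  P (ti i) = 0 -> (forall t, ti i <= t <= ti i.+1 -> is_derive t 1 P (V e t)) ->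
  forall x, 0 <= x <= 1 ->
  psi x (ti i.+1) = psi e (ti i) * expR (lam * (ti i.+1 - ti i) - P (ti i.+1)).
Proof.
set a := ti i; set c := ti i.+1 => ac [cpsi dpsi lpsi] Pa dP.
have cI : `]a, c]%classic c by rewrite /= in_itv /= ac lexx.
pose E t := expR (-1 * ((lam * (t - a) - P t) - 0)).
pose E' t := expR (-1 * ((lam * (t - a) - P t) - 0)) * (-1 * (lam - V e t)).
have dE t : a <= t <= c -> is_derive t 1 E (E' t).
  move=> tI; apply: is_derive_exp_comp; apply: is_derive_affine.
  apply: is_deriveB; last exact: dP.
  by rewrite -[X in is_derive _ _ _ X]mulr1; apply: is_derive_affine; exact: is_derive_id.
have Ea : E a = 1 by rewrite /E subrr mulr0 Pa !subr0 mulr0 expR0.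
have cst x : 0 < x < 1 -> forall s, a < s < c -> psi x s * E s = psi x c * E c.
  move=> xI s /andP[as_ sc].
  have xI' : x \in `]0, 1[ by rewrite in_itv.
  have dg t : a < t < c -> is_derive t 1 (fun t => psi x t * E t) 0.
    move=> /andP[at_ tc].
    have tI : t \in `]a, c] by rewrite in_itv /= at_ ltW.
    have [l /is_derive_withinP H El] := dpsi x t xI' tI.
    have dl : is_derive t 1 (psi x) l.
      apply/is_deriveP => r r0; have [d d0 hd] := H r r0.
      exists (Num.min d (Num.min (t - a) (c - t))).
        by rewrite !lt_min d0 !subr_gt0 at_.
      move=> y; rewrite !lt_min !ltr_norml => /and3P[/andP[? ?] /andP[? ?] /andP[? ?]].
      have [->|yNt] := eqVneq y t; first by rewrite !subrr mulr0 subr0 normr0 mulr0.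
      have h0 : y - t != 0 by rewrite subr_eq0.
      rewrite -ler_pdivrMr ?normr_gt0// -normf_div mulrBl mulfK//.
      have y1 : a < y by lra.
      have y2 : y <= c by lra.
      apply: hd => //; first by rewrite /= in_itv /= y1 y2.
      by rewrite ltr_norml; apply/andP; split; lra.
    have tI' : a <= t <= c by rewrite !ltW.
    have H0 : l * E t + psi x t * E' t = 0.
      have -> : E' t = E t * (-1 * (lam - V e t)) by [].
      have -> : l * E t + psi x t * (E t * (-1 * (lam - V e t))) =
        (l + V e t * psi x t - lam * psi x t) * E t by ring.
      by rewrite El subrr mul0r.
    by rewrite -H0; exact: (is_derive_mul dl (dE t tI')).
  have cg : {within `[s, c], continuous (fun t => psi x t * E t)}.
    have h1 : {within `[s, c], continuous (psi x)}.
      apply/subspace_continuousP => t /=; rewrite in_itv /= => /andP[st tc].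
      have Q r : s <= r <= c -> (`[0, 1] `*` `]a, c]) (x, r).
        move=> /andP[sr rc]; case/andP: xI => ? ?; split; rewrite /= in_itv /=.
          by rewrite !ltW.
        by rewrite (lt_le_trans as_ sr) rc.
      apply/cvgrPdist_lt => r r0; rewrite near_withinE.
      have [|d d0 hd] := (within_continuous2P _ _).1 cpsi _ _ (Q t _) _ r0.
        by rewrite st.
      apply/nbhs_ballP; exists d => // z; rewrite /ball /= in_itv /= => tz zI.
      rewrite distrC; apply: hd; [exact: Q|by rewrite subrr normr0|by rewrite distrC].
    have h2 : {within `[s, c], continuous E}.
      apply: derivable_within_continuous => t; rewrite in_itv /= => /andP[st tc].
      have [|? _] := dE t; last by [].
      by apply/andP; split; lra.
    by move=> t; apply: (@cvgM R); [exact: h1|exact: h2].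
  have dg' t : t \in `]s, c[ -> is_derive t 1 (fun t => psi x t * E t) ((fun=> 0) t).
    by rewrite in_itv /= => /andP[st tc]; apply: dg; rewrite (lt_trans as_ st).
  have [t _ H] := MVT_segment (ltW sc) dg' cg.
  by apply/eqP; rewrite eq_sym -subr_eq0 H mul0r.
have val x : 0 < x < 1 -> psi x c = psi e a * (E c)^-1.
  move=> xI; have xI' : x \in `]0, 1[ by rewrite in_itv.
  have E0 t : E t != 0 by rewrite gt_eqF// expR_gt0.
  suff -> : psi e a = psi x c * E c by rewrite mulfK.
  have l1 := lpsi x xI'.
  have l2 : psi x s @[s --> a^'+] --> psi x c * E c.
    have l3 : psi x c * E c * (E s)^-1 @[s --> a^'+] --> psi x c * E c * (E a)^-1.
      apply: (@cvgM R); first exact: cvg_cst.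
      apply: (@cvgV R); first exact: E0.
      have aI : a <= a <= c by rewrite lexx ltW.
      by apply: cvg_at_right_filter; exact: (derive_continuous (dE a aI)).
    rewrite Ea invr1 mulr1 in l3; apply: cvg_trans l3; apply: near_eq_cvg.
    near=> s; rewrite -(cst x xI s) ?mulfK//.
    by apply/andP; split; near: s; [exact: nbhs_right_gt|exact: nbhs_right_lt].
  exact: (cvg_unique _ l1 l2).
have cc := within_slice cI cpsi.
move=> x xI; have -> : expR (lam * (c - a) - P c) = (E c)^-1.
  by rewrite /E -expRN; congr expR; ring.
have xI' : x \in `[0, 1] by rewrite in_itv.
apply: (@endpoint_eq (psi ^~ c) (fun=> psi e a * (E c)^-1) x xI') => //.
- exact: (@continuous_clamp1 (psi ^~ c) cc x).
- exact: (@cst_continuous _ R (psi e a * (E c)^-1)).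
Unshelve. all: by end_near. Qed.

End limit_solutions.

(** * Growth over one period *)
Section one_period.
Variable R : realType.
Implicit Types (a c e lam k x t y : R) (b f g P beta : R -> R) (u q V h psi phi : R -> R -> R).

Lemma approx_solution_interval a a' c c' beta q u : a <= a' -> c' <= c ->
  approx_solution a c beta q u -> approx_solution a' c' beta q u.
Proof.
move=> aa' c'c hu a1 c1 e a'a1 a1c1 c1c' e0; apply: hu => //.
  exact: le_lt_trans a'a1.
exact: lt_le_trans c'c.
Qed.

Lemma approx_solution_drift a c beta beta' q u :
  (forall t, a < t < c -> beta t = beta' t) ->
  approx_solution a c beta q u -> approx_solution a c beta' q u.
Proof.
move=> bb' hu a1 c1 e aa1 a1c1 c1c e0.
have [v [vx [vxx [vt [cl hv]]]]] := hu a1 c1 e aa1 a1c1 c1c e0.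
exists v, vx, vxx, vt; split => // x t xI /andP[a1t tc1].
rewrite -bb'; first by apply: hv => //; rewrite a1t.
by rewrite (lt_le_trans aa1 a1t) (le_lt_trans tc1 c1c).
Qed.

Lemma diffusion_stage a c lam lamoo k V u psi : a < c -> 0 < k ->
  {within `[0, 1] `*` [set: R], continuous (fun p : R * R => V p.1 p.2)} ->
  {within `[0, 1] `*` `[a, c], continuous (fun p : R * R => u p.1 p.2)} ->
  {within `[0, 1] `*` `[a, c], continuous (fun p : R * R => psi p.1 p.2)} ->
  approx_solution a c (fun=> 0) (fun x t => V x t - lam) u ->
  approx_solution a c (fun=> 0) (fun x t => V x t - lamoo) psi ->
  ((forall x, 0 <= x <= 1 -> u x a <= k * psi x a) ->
   forall x, 0 <= x <= 1 ->
     u x c <= k * (psi x c * expR ((lam - lamoo) * (c - a)))) /\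
  ((forall x, 0 <= x <= 1 -> k * psi x a <= u x a) ->
   forall x, 0 <= x <= 1 ->
     k * (psi x c * expR ((lam - lamoo) * (c - a))) <= u x c).
Proof.
move=> ac k0 cV cu cpsi /approx_solution_sub[u1 u2] /approx_solution_sub[p1 p2].
have [Mq Mq0 hq] := bounded_potential lam (ltW ac) cV.
have cmp w : {within `[0, 1] `*` `[a, c], continuous (fun p : R * R => w p.1 p.2)} ->
    approx_subsolution a c (fun=> 0) (fun x t => V x t - lam) w ->
    (forall x, 0 <= x <= 1 -> w x a <= 0) ->
    forall x t, 0 <= x <= 1 -> a <= t <= c -> w x t <= 0.
  have hb0 t : a <= t <= c -> `|(fun=> 0 : R) t| <= 0 by rewrite normr0.
  exact: (comparison ac (lexx 0) (ltW Mq0) hb0 hq).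
pose m := lam - lamoo.
have qE : (fun x t => V x t - lamoo - m) = (fun x t => V x t - lam).
  by apply/funext => x; apply/funext => t; rewrite /m; ring.
have := approx_subsolution_exp m k0 ac p1; have := approx_subsolution_exp m k0 ac p2.
rewrite !qE => e2 e1.
have cI : a <= c <= c by rewrite lexx ltW.
have cE : {within `[0, 1] `*` `[a, c],
    continuous (fun p : R * R => k * expR (m * (p.2 - a)))}.
  apply: continuous_subspaceT => p.
  apply: (@continuous_comp _ _ _ snd (fun t => k * expR (m * (t - a)))).
    exact: cvg_snd.
  exact: (derive_continuous (is_deriveZ k (is_derive_exp_affine m a p.2))).
have Ea : expR (m * (a - a)) = 1 by rewrite subrr mulr0 expR0.
split=> hini x xI.
- have cW : {within `[0, 1] `*` `[a, c], continuous (fun p : R * R =>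
      u p.1 p.2 + k * expR (m * (p.2 - a)) * - psi p.1 p.2)}.
    move=> p; apply: (@cvgD R R^o); first exact: cu.
    by apply: (@cvgM R); [exact: cE|apply: (@cvgN R R^o); exact: cpsi].
  have H := cmp _ cW (approx_subsolutionD u1 e2) _ x c xI cI.
  have : u x c + k * expR (m * (c - a)) * - psi x c <= 0.
    apply: H => y yI; rewrite Ea mulr1 mulrN subr_le0; exact: hini.
  by rewrite mulrN subr_le0 mulrA (mulrAC k).
- have cW : {within `[0, 1] `*` `[a, c], continuous (fun p : R * R =>
      k * expR (m * (p.2 - a)) * psi p.1 p.2 + - u p.1 p.2)}.
    move=> p; apply: (@cvgB R R^o); last exact: cu.
    by apply: (@cvgM R); [exact: cE|exact: cpsi].
  have H := cmp _ cW (approx_subsolutionD e1 u2) _ x c xI cI.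
  have : k * expR (m * (c - a)) * psi x c + - u x c <= 0.
    apply: H => y yI; rewrite Ea mulr1 subr_le0; exact: hini.
  by rewrite subr_le0 mulrA (mulrAC k).
Qed.

Lemma positive_eigenfunction T beta V lam : principal_eigenvalue T beta V lam ->
  exists phi, periodic_problem T beta V phi (fun x t => lam * phi x t) /\
    forall x t, x \in `[0, 1] -> t \in `[0, T] -> 0 < phi x t.
Proof.
move=> [_ [phi [[[h _] _] phi0]]]; exists phi; split => //.
have E : (fun x t => complex.Re (lam%:C%C * (phi x t)%:C%C)) =
    (fun x t => lam * phi x t).
  by apply/funext => x; apply/funext => t /=; rewrite mul0r subr0.
by rewrite -E.
Qed.

Section chain.
Variables (T : R) (b : R -> R) (V : R -> R -> R) (N : nat) (ti : nat -> R).
Variables (lamoo : R) (psi : R -> R -> R).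
Hypothesis hT : 0 < T.
Hypothesis Vcont : {within `[0, 1] `*` [set: R],
                continuous (fun p : R * R => V p.1 p.2)}.
Hypothesis bcont : continuous b.
Hypothesis ti0 : ti 0%N = 0.
Hypothesis tiT : ti N.+1 = T.
Hypothesis tiS : forall i, (i <= N)%N -> ti i < ti i.+1.
Hypothesis hABC : idxA N ti b `|` idxB N ti b `|` idxC N ti b
              = [set i | (i <= N)%N].
Hypothesis hpsi : limit_problem N ti b T V lamoo psi.
Hypothesis psi0 : forall x t, x \in `[0, 1] -> t \in `[0, T] -> 0 < psi x t.

(** Up to exp (+- eps), psi is multiplied by the factor that turns a solution for
    lamoo into one for lam. *)
Definition tracks_psi i (eps lam k : R) phi : Prop :=
  ((forall x, 0 <= x <= 1 -> phi x (ti i) <= k * psi x (ti i)) ->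
   forall x, 0 <= x <= 1 -> phi x (ti i.+1) <=
     k * (psi x (ti i.+1) * expR ((lam - lamoo) * (ti i.+1 - ti i))) * expR eps) /\
  ((forall x, 0 <= x <= 1 -> k * psi x (ti i) <= phi x (ti i)) ->
   forall x, 0 <= x <= 1 ->
     k * (psi x (ti i.+1) * expR ((lam - lamoo) * (ti i.+1 - ti i))) * expR (- eps)
     <= phi x (ti i.+1)).

Lemma ti_itv i : (i <= N.+1)%N -> ti i \in `[0, T].
Proof.
move=> iN; rewrite in_itv /=; apply/andP; split.
  elim: i iN => [|i IH] iN; first by rewrite ti0.
  by rewrite (le_trans (IH (ltnW iN)))// ltW// tiS.
have up j : (i + j <= N.+1)%N -> ti i <= ti (i + j)%N.
  elim: j => [|j IH]; first by rewrite addn0.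
  by rewrite addnS => ij; rewrite (le_trans (IH (ltnW ij)))// ltW// tiS.
by have := up (N.+1 - i)%N; rewrite (subnKC iN) tiT; apply.
Qed.

Lemma stage_cases i : (i <= N)%N -> [\/ idxA N ti b i, idxB N ti b i | idxC N ti b i].
Proof.
move=> iN; have : [set i | (i <= N)%N] i by [].
by rewrite -hABC => -[[?|?]|?]; [constructor 1|constructor 2|constructor 3].
Qed.

Lemma psi_slice_end i : (i <= N)%N -> {within `[0, 1], continuous (psi ^~ (ti i.+1))}.
Proof.
move=> iN; case: hpsi => hA hB hC _ _.
have o : `]ti i, ti i.+1]%classic (ti i.+1) by rewrite /= in_itv /= tiS// lexx.
have d : `[ti i, ti i.+1]%classic (ti i.+1) by rewrite /= in_itv /= lexx ltW// tiS.
case: (stage_cases iN) => [/hA[c _ _]|/hB[c _ _]|/hC[c _ _]].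
- exact: within_slice o c.
- exact: within_slice d c.
- exact: within_slice o c.
Qed.

Lemma psi_periodic x : 0 <= x <= 1 -> psi x 0 = psi x T.
Proof.
move=> xI; have xI' : x \in `[0, 1] by rewrite in_itv.
case: hpsi => _ _ _ neu per.
have [/andP[x0 x1]|] := boolP (0 < x < 1).
  by apply: per; rewrite in_itv /= x0.
rewrite negb_and -!leNgt => xe.
have OI : (0 : R) \in `[0, T] by rewrite in_itv /= lexx ltW.
have [n0 n1] := neu 0 OI.
have cT : {within `[0, 1], continuous (psi ^~ T)}.
  by rewrite -tiT; exact: psi_slice_end.
apply: (@endpoint_eq R (psi ^~ 0) (psi ^~ T) x xI').
- have [xle|xge] := orP xe.
    have -> : x = 0 by apply/eqP; rewrite eq_le xle; case/andP: xI.
    by apply: continuous_of_derive_within n0; rewrite in_itv /= lexx ler01.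
  have -> : x = 1 by apply/eqP; rewrite eq_le xge andbT; case/andP: xI.
  by apply: continuous_of_derive_within n1; rewrite in_itv /= lexx ler01.
- exact: (@continuous_clamp1 R (psi ^~ T) cT x).
- by move=> y /andP[y0 y1]; apply: per; rewrite in_itv /= y0.
Qed.

Lemma psi_slice i : (i <= N.+1)%N -> {within `[0, 1], continuous (psi ^~ (ti i))}.
Proof.
case: i => [_|i iN]; last exact: psi_slice_end.
apply: (@within_eq R (psi ^~ T)); first by rewrite -tiT; exact: psi_slice_end.
by move=> x xI; rewrite ti0 psi_periodic.
Qed.

Lemma psi_pos i x : (i <= N.+1)%N -> 0 <= x <= 1 -> 0 < psi x (ti i).
Proof. by move=> iN xI; apply: psi0; [rewrite in_itv|exact: ti_itv]. Qed.

Lemma problem_approx alpha lam phi i : (i <= N)%N ->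
  periodic_problem T (fun t => alpha * b t) V phi (fun x t => lam * phi x t) ->
  {within `[0, 1] `*` `[ti i, ti i.+1],
    continuous (fun p : R * R => phi p.1 p.2)} /\
  approx_solution (ti i) (ti i.+1) (fun t => alpha * b t) (fun x t => V x t - lam) phi.
Proof.
move=> iN [sphi neu _].
have : ti i \in `[0, T] by apply: ti_itv; exact: leqW.
have : ti i.+1 \in `[0, T] by exact: ti_itv.
rewrite !in_itv /= => /andP[_ h2] /andP[h1 _].
split.
  case: sphi => ? [? [? [[[c _ _] _] _]]].
  apply: continuous_subspaceW c => -[x t] [xI tI]; split=> //.
  by apply: subset_itvScc tI; rewrite bnd_simp.
apply: (approx_solution_interval h1 h2); apply: strong_solution_approx => //.
by move=> t; apply: (@continuousM R R); [exact: cst_continuous|exact: bcont].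
Qed.

Lemma inflow_A i : idxA N ti b i -> inflow (ti i) (ti i.+1) 0 b.
Proof.
move=> [_ hb]; split=> [t tI|x t /andP[x0 x1] tI].
  by rewrite lt_eqF// hb// in_itv.
have bt : b t < 0 by apply: hb; rewrite in_itv.
rewrite subr0 ltr0_norm// ler_pM2l ?oppr_gt0// expr2.
by rewrite ler_piMl.
Qed.

Lemma inflow_C i : idxC N ti b i -> inflow (ti i) (ti i.+1) 1 b.
Proof.
move=> [_ hb]; split=> [t tI|x t /andP[x0 x1] tI].
  by rewrite gt_eqF// hb// in_itv.
have bt : 0 < b t by apply: hb; rewrite in_itv.
rewrite gtr0_norm// mulNr -mulrN ler_pM2l//.
have -> : (x - 1) ^+ 2 = (1 - x) * (1 - x) by ring.
by rewrite opprB ler_piMl ?subr_ge0// gerBl.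
Qed.

Lemma transport_growth i e (eps : R) : (i <= N)%N -> 0 < eps -> 0 <= e <= 1 ->
  inflow (ti i) (ti i.+1) e b -> ode_piece ti V lamoo psi i e ->
  exists A0, forall alpha, A0 < alpha -> forall lam phi k, 0 < k ->
    periodic_problem T (fun t => alpha * b t) V phi (fun x t => lam * phi x t) ->
    tracks_psi i eps lam k phi.
Proof.
move=> iN eps0 eI ib ode.
have ac := tiS iN.
have cVe : continuous (V e).
  move=> t; apply/cvgrPdist_lt => d d0.
  have Q s : (`[0, 1] `*` [set: R]) (e, s) by split; rewrite //= in_itv.
  have [r r0 hr] := (within_continuous2P _ _).1 Vcont _ _ (Q t) _ d0.
  apply/nbhs_ballP; exists r => // s; rewrite /ball /= => ts.
  by rewrite distrC; apply: hr; rewrite ?subrr ?normr0// distrC.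
have [P [Pa dP]] := exists_primitive (ltW ac) (fun t _ => cVe t).
have psiE := ode_piece_value ac ode Pa dP.
have iN' : (i <= N.+1)%N by exact: leqW.
have [A0 hA] := transport_stage ac eI eps0 bcont ib Vcont (psi_slice iN')
  (fun x => psi_pos iN') Pa dP.
exists A0 => alpha /hA H lam phi k k0 /(problem_approx iN)[cphi aphi].
have [up low] := H lam phi k k0 cphi aphi.
have E x : 0 <= x <= 1 ->
  psi x (ti i.+1) * expR ((lam - lamoo) * (ti i.+1 - ti i)) =
  psi e (ti i) * expR (lam * (ti i.+1 - ti i) - P (ti i.+1)).
  by move=> xI; rewrite psiE// -mulrA -expRD; congr (_ * expR _); ring.
by split=> hini x xI; rewrite E//; [exact: up|exact: low].
Qed.

Lemma diffusion_growth i (eps : R) : (i <= N)%N -> 0 < eps ->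
  idxB N ti b i -> pde_piece ti V lamoo psi i ->
  forall alpha lam phi k, 0 < k ->
    periodic_problem T (fun t => alpha * b t) V phi (fun x t => lam * phi x t) ->
    tracks_psi i eps lam k phi.
Proof.
move=> iN eps0 [_ b0] [cpsi spsi _] alpha lam phi k k0 /(problem_approx iN)[cphi aphi].
have ac := tiS iN.
have aphi' : approx_solution (ti i) (ti i.+1) (fun=> 0) (fun x t => V x t - lam) phi.
  apply: approx_solution_drift aphi => t /andP[at_ tc].
  by rewrite b0 ?mulr0// in_itv /= !ltW.
have apsi : approx_solution (ti i) (ti i.+1) (fun=> 0) (fun x t => V x t - lamoo) psi.
  move=> a' c' e aa' a'c' c'c e0.
  pose s := (ti i + a') / 2.
  have [s1 s2] : ti i < s /\ s < a' by rewrite /s; split; lra.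
  have sc : s < ti i.+1 by rewrite (lt_trans s2)// (lt_trans a'c').
  have sI : s \in `]ti i, ti i.+1[ by rewrite in_itv /= s1.
  have : ti i \in `[0, T] by apply: ti_itv; exact: leqW.
  have : ti i.+1 \in `[0, T] by exact: ti_itv.
  rewrite !in_itv /= => /andP[_ h2] /andP[h1 _].
  have c0 : continuous ((fun=> 0) : R -> R) by exact: cst_continuous.
  apply: (strong_solution_approx sc c0 Vcont (spsi s sI)) => // t.
  rewrite in_itv /= => /andP[st tc]; case: hpsi => _ _ _ neu _; apply: neu.
  by rewrite in_itv /= (le_trans tc h2) (le_trans h1)// (le_trans (ltW s1)).
have [up low] := diffusion_stage ac k0 Vcont cphi cpsi aphi' apsi.
have X0 x : 0 <= x <= 1 ->
    0 < k * (psi x (ti i.+1) * expR ((lam - lamoo) * (ti i.+1 - ti i))).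
  by move=> xI; rewrite mulr_gt0// mulr_gt0 ?expR_gt0// psi_pos.
split=> hini x xI.
  rewrite (le_trans (up hini x xI))// ler_pMr ?X0//.
  by rewrite -expR0 ler_expR ltW.
rewrite (le_trans _ (low hini x xI))// ger_pMr ?X0//.
by rewrite -[leRHS]expR0 ler_expR oppr_le0 ltW.
Qed.

Lemma stage_growth i (eps : R) : (i <= N)%N -> 0 < eps ->
  exists A0, forall alpha, A0 < alpha -> forall lam phi k, 0 < k ->
    periodic_problem T (fun t => alpha * b t) V phi (fun x t => lam * phi x t) ->
    tracks_psi i eps lam k phi.
Proof.
move=> iN eps0; case: hpsi => hA hB hC _ _.
case: (stage_cases iN) => [iA|iB|iC].
- apply: (transport_growth iN eps0 _ (inflow_A iA) (hA _ iA)).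
  by rewrite lexx ler01.
- by exists 0 => alpha _ lam phi k; apply: (diffusion_growth iN eps0 iB (hB _ iB)).
- apply: (transport_growth iN eps0 _ (inflow_C iC) (hC _ iC)).
  by rewrite lexx ler01.
Qed.

Lemma growth_until i (eps : R) : (i <= N.+1)%N -> 0 < eps ->
  exists A0, forall alpha, A0 < alpha -> forall lam phi k, 0 < k ->
    periodic_problem T (fun t => alpha * b t) V phi (fun x t => lam * phi x t) ->
    ((forall x, 0 <= x <= 1 -> phi x 0 <= k * psi x 0) ->
     forall x, 0 <= x <= 1 -> phi x (ti i) <=
       k * expR ((lam - lamoo) * ti i + i%:R * eps) * psi x (ti i)) /\
    ((forall x, 0 <= x <= 1 -> k * psi x 0 <= phi x 0) ->
     forall x, 0 <= x <= 1 ->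
       k * expR ((lam - lamoo) * ti i - i%:R * eps) * psi x (ti i) <= phi x (ti i)).
Proof.
move=> iN eps0; elim: i iN => [_|i IH iN].
  exists 0 => alpha _ lam phi k k0 _; rewrite ti0.
  by split=> h x xI; rewrite mulr0 mul0r ?addr0 ?subr0 expR0 mulr1; exact: h.
have [A1 h1] := IH (ltnW iN).
have [A2 h2] := stage_growth iN eps0.
exists (Num.max A1 A2) => alpha; rewrite gt_max => /andP[/h1 {}h1 /h2 {}h2].
move=> lam phi k k0 hphi; have [up low] := h1 lam phi k k0 hphi.
split=> hini x xI.
- have k'0 : 0 < k * expR ((lam - lamoo) * ti i + i%:R * eps).
    by rewrite mulr_gt0// expR_gt0.
  have [/(_ (up hini) x xI) + _] := h2 lam phi _ k'0 hphi; move/le_trans; apply.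
  rewrite le_eqVlt; apply/orP; left; apply/eqP.
  have -> : (lam - lamoo) * ti i.+1 + i.+1%:R * eps =
    ((lam - lamoo) * ti i + i%:R * eps) +
    ((lam - lamoo) * (ti i.+1 - ti i) + eps) by rewrite -natr1; ring.
  by rewrite !(expRD (_ + _)) (expRD _ eps); ring.
- have k'0 : 0 < k * expR ((lam - lamoo) * ti i - i%:R * eps).
    by rewrite mulr_gt0// expR_gt0.
  have [_ /(_ (low hini) x xI)] := h2 lam phi _ k'0 hphi; apply: le_trans.
  rewrite le_eqVlt; apply/orP; left; apply/eqP.
  have -> : (lam - lamoo) * ti i.+1 - i.+1%:R * eps =
    ((lam - lamoo) * ti i - i%:R * eps) +
    ((lam - lamoo) * (ti i.+1 - ti i) + - eps) by rewrite -natr1; ring.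
  by rewrite !(expRD (_ - _)) (expRD _ (- eps)); ring.
Qed.

(** k is an extremum of phi / psi at time 0; at a point where it is attained,
    periodicity turns the bound at time T into one for lam - lamoo alone. *)
Lemma eigenvalue_close (d : R) : 0 < d ->
  exists A0, forall alpha, A0 < alpha -> forall lam phi,
    periodic_problem T (fun t => alpha * b t) V phi (fun x t => lam * phi x t) ->
    (forall x t, x \in `[0, 1] -> t \in `[0, T] -> 0 < phi x t) ->
    `|lamoo - lam| < d.
Proof.
move=> d0; pose n : R := N.+1%:R.
have n0 : 0 < n by rewrite ltr0n.
pose eps := d * T / (n + 1).
have n1 : 0 < n + 1 by rewrite addr_gt0.
have eps0 : 0 < eps by rewrite divr_gt0// mulr_gt0.
have epsE : n * eps < d * T.
  have : (n + 1) * eps = d * T by rewrite /eps; field; rewrite gt_eqF.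
  by rewrite mulrDl mul1r; lra.
have [A0 hA] := growth_until (leqnn N.+1) eps0; rewrite tiT in hA.
exists A0 => alpha /hA{}hA lam phi hphi phi0; case: (hphi) => sphi neu per.
have OI : (0 : R) \in `[0, T] by rewrite in_itv /= lexx ltW.
have TI : T \in `[0, T] by rewrite in_itv /= lexx ltW.
have cphi : {within `[0, 1] `*` `[0, T], continuous (fun p : R * R => phi p.1 p.2)}.
  by case: sphi => ? [? [? [[[]]]]].
have c0 : {within `[0, 1], continuous (phi ^~ 0)} by exact: within_slice OI cphi.
have cT : {within `[0, 1], continuous (phi ^~ T)} by exact: within_slice TI cphi.
have phiT x : 0 <= x <= 1 -> phi x 0 = phi x T.
  move=> xI; apply: (@endpoint_eq R (phi ^~ 0) (phi ^~ T) x).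
  - by rewrite in_itv.
  - exact: (@continuous_clamp1 R (phi ^~ 0) c0 x).
  - exact: (@continuous_clamp1 R (phi ^~ T) cT x).
  - by move=> y /andP[y0 y1]; apply: per; rewrite in_itv /= y0.
have p0 := psi_slice (leq0n N.+1); rewrite ti0 in p0.
have psi00 x : 0 <= x <= 1 -> 0 < psi x 0.
  by move=> xI; apply: psi0 => //; rewrite in_itv.
have phi00 x : 0 <= x <= 1 -> 0 < phi x 0.
  by move=> xI; apply: phi0 => //; rewrite in_itv.
have cr : {within `[0, 1], continuous (fun x => phi x 0 / psi x 0)}.
  apply/subspace_continuousP => x xI; apply: (@cvgM R).
    by have /subspace_continuousP := c0; apply.
  apply: (@cvgV R); first by rewrite gt_eqF// psi00// -in_itv.
  by have /subspace_continuousP := p0; apply.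
have rK x : 0 <= x <= 1 -> phi x 0 / psi x 0 * psi x 0 = phi x 0.
  by move=> xI; rewrite divfK// gt_eqF// psi00.
have key x (y : R) : 0 <= x <= 1 -> phi x 0 / psi x 0 * expR y * psi x T = expR y * phi x 0.
  by move=> xI; rewrite -psi_periodic// mulrAC rK// mulrC.
have ratio0 x : 0 <= x <= 1 -> 0 < phi x 0 / psi x 0.
  by move=> xI; rewrite divr_gt0 ?phi00 ?psi00.
rewrite distrC ltr_norml; apply/andP; split.
- have [x0] := EVT_max (@ler01 R) cr; rewrite in_itv /= => x0I hmax.
  have [up _] := hA lam phi _ (ratio0 x0 x0I) hphi.
  have : phi x0 T <= expR ((lam - lamoo) * T + n * eps) * phi x0 0.
    rewrite -key//; apply: up => // y yI.
    by rewrite -ler_pdivrMr ?psi00//; apply: hmax; rewrite in_itv.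
  rewrite -phiT// ler_pMl ?phi00// -[leLHS]expR0 ler_expR => h.
  have : 0 < (lam - lamoo + d) * T by rewrite mulrDl; lra.
  by rewrite pmulr_lgt0//; lra.
- have [x0] := EVT_min (@ler01 R) cr; rewrite in_itv /= => x0I hmin.
  have [_ low] := hA lam phi _ (ratio0 x0 x0I) hphi.
  have : expR ((lam - lamoo) * T - n * eps) * phi x0 0 <= phi x0 T.
    rewrite -key//; apply: low => // y yI.
    by rewrite -ler_pdivlMr ?psi00//; apply: hmin; rewrite in_itv.
  rewrite -phiT// ger_pMl ?phi00// -[leRHS]expR0 ler_expR => h.
  have : 0 < (d - (lam - lamoo)) * T by rewrite mulrBl; lra.
  by rewrite pmulr_lgt0//; lra.
Qed.

End chain.
End one_period.

Theorem theorem1p3 (R : realType) (T : R) (b : R -> R) (V : R -> R -> R)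
    (N : nat) (ti : nat -> R) (lam : R -> R) (lamoo : R)
    (hT : 0 < T)
    (Vcont : {within `[0, 1] `*` [set: R],
                continuous (fun p : R * R => V p.1 p.2)})
    (Vper : forall x t, x \in `[0, 1] -> V x (t + T) = V x t)
    (bcont : continuous b)
    (bper : forall t, b (t + T) = b t)
    (ti0 : ti 0%N = 0)
    (tiT : ti N.+1 = T)
    (tiS : forall i, (i <= N)%N -> ti i < ti i.+1)
    (hABC : idxA N ti b `|` idxB N ti b `|` idxC N ti b
              = [set i | (i <= N)%N])
    (hlam : forall alpha, 0 < alpha ->
       principal_eigenvalue T (fun t => alpha * b t) V (lam alpha))
    (hlamoo : limit_principal_eigenvalue N ti b T V lamoo) :
  lam alpha @[alpha --> +oo] --> lamoo.
Proof.
have [psi [hpsi psi0]] := hlamoo.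
apply/cvgrPdist_lt => d d0.
have [A0 hA] := eigenvalue_close hT Vcont bcont ti0 tiT tiS hABC hpsi psi0 d0.
near=> alpha.
have alpha0 : 0 < alpha.
  by near: alpha; apply: nbhs_pinfty_gt; exact: num_real.
have [phi [hphi phi0]] := positive_eigenfunction (hlam _ alpha0).
apply: hA hphi phi0.
by near: alpha; apply: nbhs_pinfty_gt; exact: num_real.
Unshelve. all: by end_near. Qed.
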